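(* Let $F\in\mathbb{D}^{\infty,2,\sigma}$. Then $$\mathrm{var}(F):=\|F-\tau(F)\|_2^2=\sum_{n=1}^{\infty}\big\|\tau^{\otimes(n+1)}(\nabla^nF)\big\|^2_{L^2(\mathbb{R}_+^n)},$$ where $\tau^{\otimes(n+1)}(\nabla^nF)$ is understood pointwise almost everywhere, as the function $(t_1,\dots,t_n)\mapsto\tau^{\otimes(n+1)}(\nabla^n_{t_1,\dots,t_n}F)$ on $\mathbb{R}_+^n$ with Lebesgue measure.
   Context: Setting. Inner products are linear in the first variable. On the full Fock space $\mathbb{C}\Omega\oplus\bigoplus_{n\ge1}L^2(\mathbb{R}_+)^{\otimes n}$ (complex $L^2$, $\|\Omega\|=1$), let $l(h)$ be the left creation operator, $l(h)\Omega=h$, $l(h)(g_1\otimes\cdots\otimes g_n)=h\otimes g_1\otimes\cdots\otimes g_n$, and for real-valued $h\in L^2_{\mathbb{R}}(\mathbb{R}_+)$ let $S(h)=l(h)+l(h)^*$. $\mathcal{SC}$ is the von Neumann algebra generated by $\{S(h):h\in L^2_{\mathbb{R}}(\mathbb{R}_+)\}$ and $\tau(X)=\langle X\Omega,\Omega\rangle$ its faithful normal tracial state; $L^2(\mathcal{SC})$ has inner product $\langle X,Y\rangle=\tau(Y^*X)$. $\mathcal{SC}_{alg}$ is the unital $*$-algebra generated by the $S(h)$, $h\in L^2_{\mathbb{R}}(\mathbb{R}_+)$. Malliavin derivative. $\nabla$ is the linear map on $\mathcal{SC}_{alg}$, $A\mapsto(\nabla_tA)_{t\ge0}$, with $\nabla_tS(h)=h(t)\,1\otimes1$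 and $\nabla_t(AB)=A\cdot\nabla_tB+\nabla_tA\cdot B$, where $A\cdot(x\otimes y)\cdot B=Ax\otimes yB$. Iterated derivatives on $\mathcal{SC}_{alg}$: for $n\ge1$, $\nabla^n_{t_1,\dots,t_n}=(\mathrm{id}^{\otimes(n-1)}\otimes\nabla_{t_n})\circ\cdots\circ(\mathrm{id}\otimes\nabla_{t_2})\circ\nabla_{t_1}$; set $D^n=n!\,\nabla^n$. Let $\mathbb{M}_2^{k,k+1}=L^2(\mathbb{R}_+^k;L^2(\mathcal{SC}^{\otimes(k+1)},\tau^{\otimes(k+1)}))$. For $k\ge1$, $\nabla^k$ and $D^k$ are closable from $L^2(\mathcal{SC})$ to $\mathbb{M}_2^{k,k+1}$ (closures denoted by the same symbols). $\mathbb{D}^{k,2,\sigma}$ is the completion of $\mathcal{SC}_{alg}$ for $\|F\|_{k,2,\sigma}^2=\|F\|_2^2+\sum_{j=1}^k\|D^jF\|^2_{\mathbb{M}_2^{j,j+1}}$, and $\mathbb{D}^{\infty,2,\sigma}=\bigcap_{k\ge1}\mathbb{D}^{k,2,\sigma}$. *)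

(* Defs.v *)
(* Complex scalars are R[i], from real-closed. *)
From HB Require Import structures.
From mathcomp Require Import all_boot all_order all_algebra.
From mathcomp Require Import sesquilinear complex.
From mathcomp Require Import all_classical all_reals all_analysis.

Set Implicit Arguments.
Unset Strict Implicit.
Unset Printing Implicit Defensive.
Import Order.TTheory GRing.Theory Num.Theory.
Import numFieldNormedType.Exports.
Local Open Scope classical_set_scope.
Local Open Scope ring_scope.
Local Open Scope complex_scope.

(* Functions on R_+ are represented by functions on R: [leb R] does not charge
   the negative half-line. *)
Section leb.
Context (R : realType).

Definition leb : set (measurableTypeR R) -> \bar R :=
  mrestr lebesgue_measure
    (measurable_itv `[0 : R, +oo[ : measurable (`[0 : R, +oo[%classic : set (measurableTypeR R))).

Let leb0 : leb set0 = 0%E. Proof. exact: measure0. Qed.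
Let leb_ge0 A : (0 <= leb A)%E. Proof. exact: measure_ge0. Qed.
Let leb_sigma_additive : semi_sigma_additive leb.
Proof. exact: measure_semi_sigma_additive. Qed.

HB.instance Definition _ := isMeasure.Build _ _ _ leb
  leb0 leb_ge0 leb_sigma_additive.

Let leb_sigma_finite : sigma_finite setT leb.
Proof.
have [F FT mF] := sigma_finiteT (@lebesgue_measure R).
exists F => // i; have [mFi Fioo] := mF i; split => //.
apply: le_lt_trans Fioo; apply: le_measure; rewrite ?inE //.
by apply: measurableI => //; exact: measurable_itv.
Qed.

HB.instance Definition _ := Measure_isSigmaFinite.Build _ _ _ leb
  leb_sigma_finite.

End leb.
Arguments leb R : clear implicits.

Section leb_cons.
Context (R : realType) (n : nat).

Definition tcons (p : n.-tuple (measurableTypeR R) * measurableTypeR R) :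
    n.+1.-tuple (measurableTypeR R) := [the n.+1.-tuple _ of p.2 :: p.1].

Let measurable_tcons : measurable_fun setT tcons.
Proof. by apply: measurable_cons. Qed.

Context (m : {measure set (n.-tuple (measurableTypeR R)) -> \bar R}).

Definition leb_cons : set (n.+1.-tuple (measurableTypeR R)) -> \bar R :=
  pushforward (m \x leb R)%E tcons.

Let leb_cons0 : leb_cons set0 = 0%E. Proof. exact: measure0. Qed.
Let leb_cons_ge0 A : (0 <= leb_cons A)%E. Proof. exact: measure_ge0. Qed.
Let leb_cons_sigma_additive : semi_sigma_additive leb_cons.
Proof. exact: measure_semi_sigma_additive. Qed.

HB.instance Definition _ := isMeasure.Build _ _ _ leb_cons
  leb_cons0 leb_cons_ge0 leb_cons_sigma_additive.

End leb_cons.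

Fixpoint lebn (R : realType) (n : nat) :
    {measure set (n.-tuple (measurableTypeR R)) -> \bar R} :=
  match n with
  | 0 => \d_ ([tuple] : 0.-tuple (measurableTypeR R))
  | n.+1 => leb_cons (lebn R n)
  end.

Fact one_le_two (R : realType) : (1 <= 2%:E :> \bar R)%E.
Proof. by rewrite lee_fin ler1n. Qed.

Notation L2real R := (LfunType (leb R) (one_le_two R)).

(* Square-integrable functions, not classes modulo a.e. equality: the maps below
   only depend on the classes, since they are controlled by [L2dot]. *)
Record L2 (R : realType) := MkL2 {
  L2fun :> R -> R[i];
  L2_Re : (fun t => complex.Re (L2fun t)) \in Lfun (leb R) 2%:E;
  L2_Im : (fun t => complex.Im (L2fun t)) \in Lfun (leb R) 2%:E }.

Definition L2dot (R : realType) (g h : L2 R) : R[i] :=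
  (\int[leb R]_t complex.Re (g t * (h t)^*))%R +i*
  (\int[leb R]_t complex.Im (g t * (h t)^*))%R.

Fact zero_Lfun (R : realType) : (fun=> 0 : R) \in Lfun (leb R) 2%:E.
Proof. exact: (LfunP (0 : L2real R)). Qed.

Definition of_real (R : realType) (h : L2real R) : L2 R :=
  @MkL2 R (fun t => (h t)%:C) (LfunP h) (zero_Lfun R).

(* The library's [{dot U for conj}] is linear in the first variable. *)
Record prehilbert (R : realType) := PreHilbert {
  hsort :> lmodType R[i];
  hdot : {dot hsort for (@Num.conj R[i])} }.

Definition inner (R : realType) (H : prehilbert R) (u v : H) : R[i] :=
  hdot H u v.

Definition hnorm (R : realType) (H : prehilbert R) (u : H) : R :=
  Num.sqrt (complex.Re (inner u u)).

Definition hcvg (R : realType) (H : prehilbert R) (u : nat -> H) (l : H) : Prop :=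
  (fun n => hnorm (u n - l)) @ \oo --> (0 : R).

Definition hcauchy (R : realType) (H : prehilbert R) (u : nat -> H) : Prop :=
  forall e : R, 0 < e -> exists N, forall m n, (N <= m)%N -> (N <= n)%N ->
    hnorm (u m - u n) < e.

Record hilbert (R : realType) := Hilbert {
  hpre :> prehilbert R;
  hcomplete : forall u : nat -> hpre, hcauchy u -> exists l, hcvg u l }.

Definition span_dense (R : realType) (H : prehilbert R) (A : set H) : Prop :=
  forall (u : H) (e : R), 0 < e ->
    exists (n : nat) (c : 'I_n -> R[i]) (a : 'I_n -> H),
      (forall i, A (a i)) /\ hnorm (u - \sum_(i < n) c i *: a i) < e.

Definition bounded_op (R : realType) (H : prehilbert R) (X : H -> H) : Prop :=
  linear X /\ exists c : R, forall u, hnorm (X u) <= c * hnorm u.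

Definition is_adjoint (R : realType) (H : prehilbert R) (X Y : H -> H) : Prop :=
  forall u v, inner (X u) v = inner u (Y v).

Definition commutant (R : realType) (H : prehilbert R) (A : set (H -> H)) :
    set (H -> H) :=
  [set X | bounded_op X /\ forall Y, A Y -> X \o Y = Y \o X].

(* [ftens [:: g1; ..; gn]] is the elementary tensor g1 (x) .. (x) gn and
   [ftens [::]] is the vacuum. The inner products of the elementary tensors and
   the density of their span determine the Fock space up to a unique unitary;
   [fcrea g] and [fanni g] are then the operators l(g) and l(g)^*. *)
Record fock (R : realType) := Fock {
  fspace :> hilbert R;
  ftens : seq (L2 R) -> fspace;
  ftensE : forall gs hs : seq (L2 R), inner (ftens gs) (ftens hs) =
    if size gs == size hs then \prod_(p <- zip gs hs) L2dot p.1 p.2 else 0;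
  ftens_dense : span_dense (range ftens);
  fcrea : L2 R -> fspace -> fspace;
  fanni : L2 R -> fspace -> fspace;
  fcrea_bounded : forall g, bounded_op (fcrea g);
  fcreaE : forall g gs, fcrea g (ftens gs) = ftens (g :: gs);
  fanni_adjoint : forall g, is_adjoint (fcrea g) (fanni g) }.

Definition vacuum (R : realType) (Fk : fock R) : Fk := ftens Fk [::].

Definition semicirc (R : realType) (Fk : fock R) (h : L2real R) : Fk -> Fk :=
  fun u => fcrea (of_real h) u + fanni (of_real h) u.

(* The S(h) are bounded and self-adjoint, so the von Neumann algebra they
   generate is their bicommutant. *)
Definition SC (R : realType) (Fk : fock R) : set (Fk -> Fk) :=
  commutant (commutant (range (@semicirc R Fk))).

Definition tau (R : realType) (Fk : fock R) (X : Fk -> Fk) : R[i] :=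
  inner (X (vacuum Fk)) (vacuum Fk).

(* L^2(SC^{(x) k}, tau^{(x) k}): the completion of the k-fold algebraic tensor
   power of SC (which is L^2-dense in the von Neumann tensor power) for
   <X, Y> = tau^{(x) k}(Y^* X). [gtens X] is X_0 (x) .. (x) X_(k-1); its value
   on operators outside SC is irrelevant. *)
Record tensL2 (R : realType) (Fk : fock R) (k : nat) := TensL2 {
  gspace :> hilbert R;
  gtens : ('I_k -> Fk -> Fk) -> gspace;
  gtensE : forall X Y Ystar : 'I_k -> Fk -> Fk,
    (forall i, SC (X i)) -> (forall i, SC (Y i)) ->
    (forall i, is_adjoint (Y i) (Ystar i)) ->
    inner (gtens X) (gtens Y) = \prod_(i < k) tau (Ystar i \o X i);
  gtens_dense : span_dense (gtens @` [set X | forall i, SC (X i)]) }.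

(* The continuous extension of tau^{(x) k} to L^2: <v, 1 (x) .. (x) 1>. *)
Definition tauL2 (R : realType) (Fk : fock R) (k : nat) (H : tensL2 Fk k) (v : H) :
    R[i] :=
  inner v (gtens H (fun=> idfun)).

(* A word [:: h1; ..; hp] stands for S(h1) .. S(hp), and a polynomial for a
   complex linear combination of words; [::] is the unit. As the S(h) are
   self-adjoint, the operators [pol_op P] form the unital *-algebra SC_alg. *)
Definition word (R : realType) := seq (L2real R).
Definition pol (R : realType) := seq (R[i] * word R).

Definition word_op (R : realType) (Fk : fock R) (w : word R) : Fk -> Fk :=
  foldr (fun h X => semicirc h \o X) idfun w.

Definition pol_op (R : realType) (Fk : fock R) (P : pol R) : Fk -> Fk :=
  fun u => \sum_(p <- P) p.1 *: word_op p.2 u.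

Definition pol_sub (R : realType) (P Q : pol R) : pol R :=
  P ++ [seq (- q.1, q.2) | q <- Q].

(* nabla_s of a word, as a formal sum of terms c u (x) v, by the rule
   nabla_s (S(h) w) = S(h) . nabla_s w + h(s) 1 (x) w. *)
Fixpoint nabla_word (R : realType) (s : R) (w : word R) :
    seq (R[i] * word R * word R) :=
  if w is h :: w' then
    ((h s)%:C, [::], w') :: [seq (z.1.1, h :: z.1.2, z.2) | z <- nabla_word s w']
  else [::].

Lemma nabla_word_gen (R : realType) (s : R) (h : L2real R) :
  nabla_word s [:: h] = [:: ((h s)%:C, [::], [::])].
Proof. by []. Qed.

Lemma nabla_word_leibniz (R : realType) (s : R) (a b : word R) :
  nabla_word s (a ++ b) =
    [seq (z.1.1, z.1.2, z.2 ++ b) | z <- nabla_word s a] ++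
    [seq (z.1.1, a ++ z.1.2, z.2) | z <- nabla_word s b].
Proof.
elim: a => [|h a IHa] /=.
  by rewrite -[LHS]map_id; apply: eq_map => -[[]].
by rewrite IHa map_cat -!map_comp.
Qed.

(* A formal element of the tensor power of SC_alg: the term (c, us, w) is
   c u_1 (x) .. (x) u_m (x) w. [nabla_last s] is id (x) .. (x) id (x) nabla_s. *)
Definition ftensor (R : realType) := seq (R[i] * seq (word R) * word R).

Definition nabla_last (R : realType) (Z : ftensor R) (s : R) : ftensor R :=
  [seq (z.1.1 * y.1.1, rcons z.1.2 y.1.2, y.2) | z <- Z, y <- nabla_word s z.2].

Definition nabla_formal (R : realType) (P : pol R) (t : seq R) : ftensor R :=
  foldl (@nabla_last R) [seq (p.1, [::], p.2) | p <- P] t.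

Section sobolev.
Context (R : realType) (Fk : fock R) (L : forall k, tensL2 Fk k).

Definition pol_L2 (P : pol R) : L 1 := gtens (L 1) (fun=> pol_op P).

Definition nablan (n : nat) (P : pol R) (t : n.-tuple R) : L n.+1 :=
  \sum_(z <- nabla_formal P t)
    z.1.1 *: gtens (L n.+1) (fun i => word_op (nth [::] (rcons z.1.2 z.2) i)).

Definition Dn (n : nat) (P : pol R) (t : n.-tuple R) : L n.+1 :=
  (n`!)%:R *: nablan P t.

(* The square of the norm of M_2^{n,n+1}. *)
Definition M2normsq (n : nat) (Y : n.-tuple R -> L n.+1) : \bar R :=
  (\int[lebn R n]_t (hnorm (Y t) ^+ 2)%:E)%E.

(* Bochner measurability: pointwise limit of simple functions. *)
Definition strongly_measurable (n : nat) (Y : n.-tuple R -> L n.+1) : Prop :=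
  exists s : nat -> n.-tuple R -> L n.+1,
    [/\ forall m, finite_set (range (s m)),
        forall m v, measurable (s m @^-1` [set v] : set (n.-tuple (measurableTypeR R)))
      & forall t, hcvg (s ^~ t) (Y t)].

Definition M2 (n : nat) (Y : n.-tuple R -> L n.+1) : Prop :=
  strongly_measurable Y /\ (M2normsq Y < +oo)%E.

(* (F, Y) is in the graph of the closure of nabla^n, from L^2(SC) to
   M_2^{n,n+1}; Y is determined by F up to a.e. equality. *)
Definition closed_nablan (n : nat) (F : L 1) (Y : n.-tuple R -> L n.+1) : Prop :=
  M2 Y /\ exists P : nat -> pol R,
    hcvg (fun m => pol_L2 (P m)) F /\
    (fun m => M2normsq (fun t => nablan (P m) t - Y t)) @ \oo --> 0%E.

Definition sobolev_normsq (k : nat) (P : pol R) : \bar R :=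
  ((hnorm (pol_L2 P) ^+ 2)%:E +
   \sum_(1 <= j < k.+1) M2normsq (fun t => @Dn j P t))%E.

(* D^{k,2,sigma} inside L^2(SC): a point of the completion is represented by a
   Cauchy sequence of SC_alg, and identified with its limit in L^2(SC); this
   identification is injective since the D^j are closable. *)
Definition Dk2 (k : nat) : set (L 1) :=
  [set F | exists P : nat -> pol R,
    (forall e : R, 0 < e -> exists N, forall m l, (N <= m)%N -> (N <= l)%N ->
      (sobolev_normsq k (pol_sub (P m) (P l)) < e%:E)%E) /\
    hcvg (fun m => pol_L2 (P m)) F].

Definition Doo2 : set (L 1) := \bigcap_(k in [set k | (1 <= k)%N]) Dk2 k.

Definition var (F : L 1) : R :=
  hnorm (F - tauL2 F *: gtens (L 1) (fun=> idfun)) ^+ 2.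

End sobolev.

Arguments pol_L2 {R Fk} L P.
Arguments nablan {R Fk} L {n} P t.
Arguments Dn {R Fk} L {n} P t.
Arguments M2normsq {R Fk} L {n} Y.
Arguments strongly_measurable {R Fk} L {n} Y.
Arguments M2 {R Fk} L {n} Y.
Arguments closed_nablan {R Fk} L {n} F Y.
Arguments sobolev_normsq {R Fk} L k P.
Arguments Dk2 {R Fk} L k.
Arguments Doo2 {R Fk} L.
Arguments var {R Fk} L F.

(* Main.v *)
(* On the vacuum Omega, cutting a word S(h1) .. S(hp) at the letters that stay
   uncontracted gives
     S(h1) .. S(hp) Omega =
       sum over i1 < .. < in of tau(w_0) .. tau(w_n) h_i1 (x) .. (x) h_in,
   where w_0, .., w_n are the subwords between the cuts. The n-particle component
   is the function t |-> tau^{(x) (n+1)}(nabla^n_t), so that on SC_alg the formula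
   is the orthogonality of the Fock space: the variance is the sum of the squared
   norms of the components of positive degree. As X |-> X Omega is isometric,
   F |-> (tau^{(x) (n+1)}(nabla^n F))_n is contractive on SC_alg, while tau^{(x) (n+1)}
   is contractive on M_2^{n,n+1}; hence the formula passes to the closures. *)
Require Import Defs.
From HB Require Import structures.
From mathcomp Require Import all_boot all_order all_algebra.
From mathcomp Require Import sesquilinear complex.
From mathcomp Require Import all_classical all_reals all_analysis.
From mathcomp Require Import measurable_realfun ring lra.
Import Order.TTheory GRing.Theory Num.Theory.
Import numFieldNormedType.Exports.

Set Implicit Arguments.
Unset Strict Implicit.
Unset Printing Implicit Defensive.

(** * Real and imaginary parts of complex scalars, and the squared modulus *)

Section complex_parts.
Context (R : realType).
Local Open Scope ring_scope.
Local Open Scope complex_scope.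
Implicit Types x y z : R[i].

Lemma ReD x y : complex.Re (x + y) = complex.Re x + complex.Re y.
Proof. by case: x y => [? ?] []. Qed.

Lemma ReN x : complex.Re (- x) = - complex.Re x.
Proof. by case: x. Qed.

Lemma ImD x y : complex.Im (x + y) = complex.Im x + complex.Im y.
Proof. by case: x y => [? ?] []. Qed.

Lemma ImN x : complex.Im (- x) = - complex.Im x.
Proof. by case: x. Qed.

Lemma Re_sum I (r : seq I) (F : I -> R[i]) :
  complex.Re (\sum_(i <- r) F i) = \sum_(i <- r) complex.Re (F i).
Proof. by apply: (big_morph _ ReD). Qed.

Lemma Im_sum I (r : seq I) (F : I -> R[i]) :
  complex.Im (\sum_(i <- r) F i) = \sum_(i <- r) complex.Im (F i).
Proof. by apply: (big_morph _ ImD). Qed.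

Lemma ReMr x (a : R) : complex.Re (x * a%:C) = complex.Re x * a.
Proof. by case: x => ? ? /=; rewrite mulr0 subr0. Qed.

Lemma ImMr x (a : R) : complex.Im (x * a%:C) = complex.Im x * a.
Proof. by case: x => ? ? /=; rewrite mulr0 add0r. Qed.

(** Real-valued and free of square roots, so that it can be integrated directly; [normsqE] returns
    to the modulus at the very end. *)
Definition normsq (x : R[i]) : R := complex.Re x ^+ 2 + complex.Im x ^+ 2.

Lemma normsq_ge0 x : 0 <= normsq x.
Proof. by rewrite addr_ge0 ?sqr_ge0. Qed.

Lemma normsqN x : normsq (- x) = normsq x.
Proof. by rewrite /normsq ReN ImN !sqrrN. Qed.

Lemma normsqE x : ComplexField.Normc.normc x ^+ 2 = normsq x.
Proof. by case: x => a b /=; rewrite sqr_sqrtr// addr_ge0 ?sqr_ge0. Qed.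

Lemma mul_conj x : x * Num.conj x = (normsq x)%:C.
Proof.
case: x => a b; apply/eqP; rewrite eq_complex /normsq /=.
by apply/andP; split; apply/eqP; ring.
Qed.

Lemma conj_real (a : R) : Num.conj (a%:C) = a%:C :> R[i].
Proof. by apply/eqP; rewrite eq_complex /= oppr0 !eqxx. Qed.

(* Integrates to a substitute for Minkowski's inequality that involves no
   square root, hence no finiteness condition. *)
Lemma normsqD_le (e : R) x y : 0 < e ->
  normsq (x + y) <= (1 + e) * normsq x + (1 + e^-1) * normsq y.
Proof.
move=> e0; rewrite -subr_ge0.
suff -> : (1 + e) * normsq x + (1 + e^-1) * normsq y - normsq (x + y) =
    e^-1 * ((e * complex.Re x - complex.Re y) ^+ 2 +
            (e * complex.Im x - complex.Im y) ^+ 2).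
  by rewrite mulr_ge0 ?invr_ge0 ?addr_ge0 ?sqr_ge0// ltW.
by rewrite /normsq ReD ImD; field; rewrite gt_eqF.
Qed.

End complex_parts.

(** * Inner products and norms *)

Section prehilbert_theory.
Context (R : realType) (H : prehilbert R).
Local Open Scope ring_scope.
Local Open Scope complex_scope.
Implicit Types (u v w : H) (a : R[i]).

Lemma innerC u v : inner u v = Num.conj (inner v u).
Proof. by rewrite /inner hermC expr0 mul1r. Qed.

Lemma innerDl u v w : inner (u + v) w = inner u w + inner v w.
Proof. exact: linearDl. Qed.

Lemma innerBl u v w : inner (u - v) w = inner u w - inner v w.
Proof. exact: linearBl. Qed.

Lemma innerDr u v w : inner w (u + v) = inner w u + inner w v.
Proof. exact: linearDr. Qed.

Lemma innerBr u v w : inner w (u - v) = inner w u - inner w v.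
Proof. exact: linearBr. Qed.

Lemma innerZl a u w : inner (a *: u) w = a * inner u w.
Proof. exact: linearZl_LR. Qed.

Lemma innerZr a u w : inner w (a *: u) = Num.conj a * inner w u.
Proof. exact: linearZr_LR. Qed.

Lemma inner_suml I (r : seq I) (F : I -> H) w :
  inner (\sum_(i <- r) F i) w = \sum_(i <- r) inner (F i) w.
Proof. exact: linear_sumlz. Qed.

Lemma inner_sumr I (r : seq I) (F : I -> H) w :
  inner w (\sum_(i <- r) F i) = \sum_(i <- r) inner w (F i).
Proof. exact: linear_sumr. Qed.

Lemma inner_ge0 u : 0 <= inner u u.
Proof. exact: dnorm_ge0. Qed.

Lemma hnorm_ge0 u : 0 <= hnorm u.
Proof. exact: sqrtr_ge0. Qed.

Lemma hnorm_sqr u : hnorm u ^+ 2 = complex.Re (inner u u).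
Proof.
by rewrite sqr_sqrtr//; have := inner_ge0 u; rewrite lecE => /andP[].
Qed.

Lemma innerxx u : inner u u = (hnorm u ^+ 2)%:C.
Proof.
rewrite hnorm_sqr; have := inner_ge0 u; rewrite lecE => /andP[/eqP /= h _].
by apply/eqP; rewrite eq_complex /= h !eqxx.
Qed.

Lemma inner_inj u v : (forall w, inner u w = inner v w) -> u = v.
Proof.
move=> uv; apply/eqP; rewrite -subr_eq0 -(dnorm_eq0 (hdot H)).
by have := innerBl u v (u - v); rewrite uv subrr /inner => ->.
Qed.

Lemma hnormN u : hnorm (- u) = hnorm u.
Proof. by rewrite /hnorm /inner hnormN. Qed.

Lemma hnorm_distC u v : hnorm (u - v) = hnorm (v - u).
Proof. by rewrite -hnormN opprB. Qed.

(** The gap between the two sides is [e^-1] times the squared norm of [e u - v]. A small [e] brings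
    the coefficient of [u] close to 1, as the limit arguments for the variance require; [e = 1]
    gives the crude factor 2. *)
Lemma hnormD_sqr_le (e : R) u v : 0 < e ->
  hnorm (u + v) ^+ 2 <= (1 + e) * hnorm u ^+ 2 + (1 + e^-1) * hnorm v ^+ 2.
Proof.
move=> e0; rewrite -subr_ge0.
suff -> : (1 + e) * hnorm u ^+ 2 + (1 + e^-1) * hnorm v ^+ 2 - hnorm (u + v) ^+ 2 =
    e^-1 * hnorm (e%:C *: u - v) ^+ 2.
  by rewrite mulr_ge0 ?sqr_ge0// invr_ge0 ltW.
rewrite !hnorm_sqr !(innerBl, innerBr, innerDl, innerDr, innerZl, innerZr).
rewrite conj_real (innerC v u).
move: (inner u u) (inner v v) (inner u v) => [a ?] [b ?] [c d] /=.
by field; rewrite gt_eqF.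
Qed.

(** Pythagoras for the projection onto the line of [v]; it yields both the formula for the variance
    and the Cauchy-Schwarz bound that follows. *)
Lemma hnorm_sub_unit u v : hnorm v = 1 ->
  hnorm (u - inner u v *: v) ^+ 2 = hnorm u ^+ 2 - normsq (inner u v).
Proof.
move=> v1; rewrite !hnorm_sqr !(innerBl, innerBr, innerZl, innerZr).
rewrite (innerxx v) v1 expr1n (innerC v u).
move: (inner u u) (inner u v) => [a ?] [c d] /=; rewrite /normsq /=.
by ring.
Qed.

Lemma normsq_inner_le u v : hnorm v = 1 -> normsq (inner u v) <= hnorm u ^+ 2.
Proof. by move=> v1; rewrite -subr_ge0 -hnorm_sub_unit// sqr_ge0. Qed.

End prehilbert_theory.

(** * Bounded operators and their adjoints *)

Section bounded_operators.
Context (R : realType) (H : prehilbert R).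
Local Open Scope ring_scope.
Local Open Scope complex_scope.
Implicit Types X Y : H -> H.

Lemma is_adjointC X Y : is_adjoint X Y -> is_adjoint Y X.
Proof. by move=> XY u v; rewrite innerC -XY -innerC. Qed.

Lemma is_adjoint_comp X Y X' Y' :
  is_adjoint X X' -> is_adjoint Y Y' -> is_adjoint (X \o Y) (Y' \o X').
Proof. by move=> hX hY u v /=; rewrite hX hY. Qed.

Lemma adjoint_linear X Y : is_adjoint X Y -> linear Y.
Proof.
move=> /is_adjointC h a u v; apply: inner_inj => w.
by rewrite !(innerDl, innerZl, h).
Qed.

Lemma linearfunD X : linear X -> {morph X : u v / u + v}.
Proof. by move=> lX u v; have := lX 1 u v; rewrite !scale1r. Qed.

Lemma linearfun0 X : linear X -> X 0 = 0.
Proof. by move=> lX; have := lX (-1) 0 0; rewrite scaler0 scaleN1r addr0 addNr. Qed.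

Lemma linearfunZ X a : linear X -> {morph X : u / a *: u}.
Proof. by move=> lX u; have := lX a u 0; rewrite (linearfun0 lX) !addr0. Qed.

Lemma linearfun_sum X I (r : seq I) (F : I -> H) : linear X ->
  X (\sum_(i <- r) F i) = \sum_(i <- r) X (F i).
Proof.
by move=> lX; apply: (big_morph X (linearfunD lX) (linearfun0 lX)).
Qed.

(** A positive constant lets bounds be multiplied and squared; [bounded_op] itself leaves the sign
    free. *)
Lemma bounded_opP X : bounded_op X <->
  linear X /\ exists2 c : R, 0 < c & forall u, hnorm (X u) <= c * hnorm u.
Proof.
split => -[lX [c hc]]; split => //; last by exists c.
exists (Num.max c 1); first by rewrite lt_max ltr01 orbT.
move=> u; rewrite (le_trans (hc u))// ler_wpM2r ?hnorm_ge0//.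
by rewrite le_max lexx.
Qed.

Lemma bounded_op_id : bounded_op (idfun : H -> H).
Proof. by split => //; exists 1 => u; rewrite mul1r. Qed.

Lemma bounded_op_comp X Y : bounded_op X -> bounded_op Y -> bounded_op (X \o Y).
Proof.
move=> /bounded_opP[lX [c c0 hc]] /bounded_opP[lY [d d0 hd]]; split.
  by move=> a u v /=; rewrite lY lX.
exists (c * d) => u /=; rewrite (le_trans (hc _))// -mulrA ler_wpM2l//.
exact: ltW.
Qed.

Lemma bounded_opD X Y : bounded_op X -> bounded_op Y ->
  bounded_op (fun u => X u + Y u).
Proof.
move=> /bounded_opP[lX [c c0 hc]] /bounded_opP[lY [d d0 hd]]; split.
  move=> a u v /=; rewrite lX lY scalerDr.
  by rewrite -!addrA; congr (_ + _); rewrite addrCA.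
(* The squared norm of the sum is at most 2 (c^2 + d^2) times that of [u], and 2 (c^2 + d^2) <= 4 (c
   + d)^2. *)
exists (2 * (c + d)) => u.
rewrite -(@ler_pXn2r _ 2)// ?nnegrE ?hnorm_ge0//; last first.
  by rewrite mulr_ge0 ?hnorm_ge0// mulr_ge0// addr_ge0// ltW.
apply: le_trans (hnormD_sqr_le _ _ ltr01) _.
have h1 : hnorm (X u) ^+ 2 <= (c * hnorm u) ^+ 2.
  by rewrite ler_pXn2r ?nnegrE ?hnorm_ge0// mulr_ge0 ?hnorm_ge0// ltW.
have h2 : hnorm (Y u) ^+ 2 <= (d * hnorm u) ^+ 2.
  by rewrite ler_pXn2r ?nnegrE ?hnorm_ge0// mulr_ge0 ?hnorm_ge0// ltW.
have := mulr_ge0 (ltW c0) (ltW d0); have := sqr_ge0 (hnorm u).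
move: h1 h2; rewrite !exprMn invr1.
move: (hnorm u ^+ 2) (hnorm (X u) ^+ 2) (hnorm (Y u) ^+ 2) => p q r h1 h2 p0 cd0.
have := sqr_ge0 c; have := sqr_ge0 d; nra.
Qed.

Lemma bounded_opZ a X : bounded_op X -> bounded_op (fun u => a *: X u).
Proof.
move=> /bounded_opP[lX [c c0 hc]]; split.
  by move=> b u v /=; rewrite lX scalerDr !scalerA mulrC.
exists (Num.sqrt (normsq a) * c) => u.
rewrite -mulrA; apply: le_trans (ler_wpM2l (sqrtr_ge0 _) (hc u)).
rewrite -(@ler_pXn2r _ 2)// ?nnegrE ?hnorm_ge0//; last first.
  by rewrite mulr_ge0 ?hnorm_ge0 ?sqrtr_ge0.
rewrite exprMn !hnorm_sqr sqr_sqrtr ?normsq_ge0// innerZl innerZr mulrA mul_conj.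
by rewrite mulrC ReMr mulrC.
Qed.

(** The constant [c] of [X] also serves for [Y]. The squared norm of [X (Y v) - c^2 v] is
    nonnegative; expanding it, and bounding [X (Y v)] by [c] times [Y v], leaves c^2 |Y v|^2 <= c^4
    |v|^2. *)
Lemma bounded_adjoint X Y : is_adjoint X Y -> bounded_op X -> bounded_op Y.
Proof.
move=> XY /bounded_opP[lX [c c0 hc]]; split; first exact: adjoint_linear XY.
exists c => v; rewrite -(@ler_pXn2r _ 2)// ?nnegrE ?hnorm_ge0//; last first.
  by rewrite mulr_ge0 ?hnorm_ge0// ltW.
have := sqr_ge0 (hnorm (X (Y v) - (c ^+ 2)%:C *: v)).
rewrite hnorm_sqr !(innerBl, innerBr, innerZl, innerZr) conj_real.
rewrite (innerC v) (XY _ v) !innerxx conj_real exprMn.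
have : hnorm (X (Y v)) ^+ 2 <= c ^+ 2 * hnorm (Y v) ^+ 2.
  by rewrite -exprMn ler_pXn2r ?nnegrE ?hnorm_ge0// mulr_ge0 ?hnorm_ge0// ltW.
move: (hnorm (X _) ^+ 2) (hnorm (Y v) ^+ 2) (hnorm v ^+ 2) => p q r /=.
have : 0 < c ^+ 2 by rewrite exprn_gt0.
move: (c ^+ 2) => C C0 h1 h2.
rewrite -(ler_pM2l C0).
move: h1 h2; rewrite ?(mulr0, mul0r, subr0, addr0, add0r); lra.
Qed.

End bounded_operators.

(** * Cutting a word at one letter *)

Section cuts.
Context (T : eqType).

(** Common index set of the two sides to be compared: the terms of [nabla_word] (see
    [nabla_word_cuts]) and the particles created by a word on the vacuum (see [word_vacuum]). *)
Fixpoint cuts (w : seq T) : seq (seq T * T * seq T) :=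
  if w is h :: w' then
    ([::], h, w') :: [seq (h :: z.1.1, z.1.2, z.2) | z <- cuts w']
  else [::].

Lemma size_cuts w z : z \in cuts w -> (size z.1.1 + size z.2 < size w)%N.
Proof.
elim: w z => //= h w IHw z; rewrite inE => /orP[/eqP -> /=|/mapP[y /IHw yw ->]].
  by rewrite add0n.
by rewrite /= addSn ltnS.
Qed.

(** Both sides run over the ordered pairs of marked letters: the left marks the earlier letter
    first, the right the later one. *)
Lemma big_cuts_cuts (V : nmodType) (f : seq T -> T -> seq T -> T -> seq T -> V) w :
  (\sum_(z <- cuts w) \sum_(y <- cuts z.2) f z.1.1 z.1.2 y.1.1 y.1.2 y.2 =
   \sum_(z <- cuts w) \sum_(y <- cuts z.1.1) f y.1.1 y.1.2 y.2 z.1.2 z.2)%R.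
Proof.
elim: w f => [|h w IHw] f; first by rewrite /= !big_nil.
rewrite /= !big_cons /= big_nil add0r !big_map /=.
rewrite (IHw (fun u => f (h :: u))) -big_split /=.
apply: eq_bigr => z _; rewrite big_cons big_map /=.
by [].
Qed.

End cuts.

(** * Creation, annihilation and words of semicirculars on the vacuum *)

Section fock_space.
Context (R : realType) (Fk : fock R).
Local Open Scope ring_scope.
Local Open Scope complex_scope.
Implicit Types (g h k : L2real R) (w : word R).
Local Notation wop := (@word_op R Fk).
Local Notation pop := (@pol_op R Fk).

Definition rdot h k : R := \int[leb R]_t (h t * k t).

Lemma rdotC h k : rdot h k = rdot k h.
Proof. by apply: eq_Rintegral => t _; rewrite mulrC. Qed.

Lemma L2dot_of_real h k : L2dot (of_real h) (of_real k) = (rdot h k)%:C.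
Proof.
apply/eqP; rewrite eq_complex /=; apply/andP; split; apply/eqP.
  by apply: eq_Rintegral => t _; rewrite oppr0 mulr0 subr0.
rewrite /Rintegral integral0_eq// => t _ /=.
by rewrite oppr0 mulr0 mul0r addr0.
Qed.

(** A vector orthogonal to all elementary tensors is at distance at least [hnorm x] from every
    element of their span, so density with [e = hnorm x] is contradicted unless [x] vanishes. *)
Lemma ftens_total (x : Fk) : (forall hs, inner x (ftens Fk hs) = 0) -> x = 0.
Proof.
move=> x0; apply/eqP; rewrite -(dnorm_eq0 (hdot Fk)).
suff : hnorm x ^+ 2 = 0 by have := innerxx x; rewrite /inner => -> ->.
apply/eqP; rewrite sqrf_eq0 eq_le hnorm_ge0 andbT leNgt; apply/negP => x_gt0.
have [n [c [a [aA]]]] := ftens_dense x x_gt0; apply/negP; rewrite -leNgt.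
set s := \sum_(i < n) _.
have xs : inner x s = 0.
  rewrite inner_sumr big1// => i _; have [hs _ <-] := aA i.
  by rewrite innerZr x0 mulr0.
rewrite -(@ler_pXn2r _ 2)// ?nnegrE ?hnorm_ge0// !hnorm_sqr.
rewrite !(innerBl, innerBr) xs (innerC s) xs conjC0 subr0 sub0r opprK ReD.
by rewrite lerDl -hnorm_sqr sqr_ge0.
Qed.

Lemma fanni_bounded (f : L2 R) : bounded_op (fanni f : Fk -> Fk).
Proof. exact: bounded_adjoint (@fanni_adjoint R Fk f) (@fcrea_bounded R Fk f). Qed.

Lemma fanni_vacuum (f : L2 R) : fanni f (vacuum Fk) = 0.
Proof.
apply: ftens_total => hs; rewrite (is_adjointC (fanni_adjoint f)) fcreaE.
by rewrite ftensE.
Qed.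

Lemma fanni_ftens g h hs : fanni (of_real g) (ftens Fk (of_real h :: hs)) =
  (rdot g h)%:C *: ftens Fk hs.
Proof.
apply/eqP; rewrite -subr_eq0; apply/eqP; apply: ftens_total => ks.
rewrite innerBl (is_adjointC (fanni_adjoint _)) fcreaE innerZl !ftensE /=.
rewrite eqSS; case: ifP => _; last by rewrite mulr0 subrr.
by rewrite big_cons /= L2dot_of_real rdotC subrr.
Qed.

(** The relation l(g)^* l(h) = <h, g> of the full Fock space. Against an elementary tensor, both
    operators move to the other side and [fanni_ftens] applies. *)
Lemma fanni_fcrea g h (u : Fk) :
  fanni (of_real g) (fcrea (of_real h) u) = (rdot g h)%:C *: u.
Proof.
apply/eqP; rewrite -subr_eq0; apply/eqP; apply: ftens_total => ks.
rewrite innerBl (is_adjointC (fanni_adjoint _)) fcreaE (fanni_adjoint _).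
by rewrite fanni_ftens innerZl innerZr conj_real rdotC subrr.
Qed.

Lemma semicirc_adjoint h : is_adjoint (@semicirc R Fk h) (@semicirc R Fk h).
Proof.
move=> u v; rewrite innerDl innerDr addrC; congr (_ + _).
  exact: (is_adjointC (fanni_adjoint _)).
exact: fanni_adjoint.
Qed.

Lemma semicirc_bounded h : bounded_op (@semicirc R Fk h).
Proof. exact: bounded_opD (@fcrea_bounded R Fk _) (fanni_bounded _). Qed.

Lemma word_op_cat w w' : wop (w ++ w') = wop w \o wop w'.
Proof. by elim: w => //= h w ->. Qed.

Lemma word_op_adjoint w : is_adjoint (wop w) (wop (rev w)).
Proof.
elim: w => [|h w IHw]; first by [].
rewrite rev_cons -cats1 word_op_cat /=.
exact: is_adjoint_comp (semicirc_adjoint h) IHw.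
Qed.

(** Whatever commutes with every letter commutes with every word, by induction on the word. *)
Lemma word_op_SC w : SC (wop w).
Proof.
split; last move=> Y [_ YS].
  elim: w => [|h w IHw]; first exact: bounded_op_id.
  exact: bounded_op_comp (semicirc_bounded h) IHw.
elim: w => // h w IHw; apply/funext => u /=.
have /(congr1 (fun f => f (wop w u))) /= := YS (semicirc h) (ex_intro2 _ _ h I erefl).
move=> ->; congr (semicirc _ _).
by have /(congr1 (fun f => f u)) := IHw.
Qed.

Lemma pol_op_SC (P : pol R) : SC (pop P).
Proof.
have pol_op_cons (p : R[i] * word R) Q :
    pop (p :: Q) = fun u => p.1 *: wop p.2 u + pop Q u.
  by apply/funext => u; rewrite /pol_op big_cons.
split; last move=> Y YS.
  elim: P => [|p P IHP].
    split; first by move=> a u v; rewrite /pol_op !big_nil scaler0 addr0.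
    exists 0 => u; rewrite /pol_op big_nil /hnorm /inner linear0l.
    by rewrite sqrtr0 mul0r.
  rewrite pol_op_cons; apply: bounded_opD => //; apply: bounded_opZ.
  by have [] := word_op_SC p.2.
have [[lY _] _] := YS.
apply/funext => u; rewrite /= /pol_op linearfun_sum//.
apply: eq_bigr => p _; rewrite (linearfunZ _ lY); congr (_ *: _).
by have [_ /(_ _ YS) /(congr1 (fun f => f u))] := word_op_SC p.2.
Qed.

Lemma pol_op_adjoint (P : pol R) : exists Pstar, is_adjoint (pop P) Pstar.
Proof.
exists (fun v => \sum_(p <- P) Num.conj p.1 *: wop (rev p.2) v) => u v.
rewrite inner_suml inner_sumr; apply: eq_bigr => p _.
by rewrite innerZl innerZr conjCK word_op_adjoint.
Qed.

Definition wtau w : R[i] := tau (wop w).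

Lemma wtau_nil : wtau [::] = 1.
Proof. by rewrite /wtau /tau /= ftensE eqxx big_nil. Qed.

(* A cut of [w] that isolates a letter left uncontracted creates a particle:
   what precedes it contributes its moment, what follows it acts on the vacuum. *)
Lemma word_vacuum w : wop w (vacuum Fk) = wtau w *: vacuum Fk +
  \sum_(z <- cuts w) wtau z.1.1 *: fcrea (of_real z.1.2) (wop z.2 (vacuum Fk)).
Proof.
set O := vacuum Fk.
(* Strong induction on the length, since the formula is needed for both halves of a cut. *)
have [n] := ubnP (size w); elim: n w => // n IHn [_|h w].
  by rewrite /= big_nil addr0 wtau_nil scale1r.
rewrite ltnS /= => wn.
(* Annihilation kills the vacuum term and contracts [h] with the first particle of each other
   term. *)
have anniE v : (size v < n)%N -> fanni (of_real h) (wop v O) =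
    \sum_(z <- cuts v) (wtau z.1.1 * (rdot h z.1.2)%:C) *: wop z.2 O.
  move=> vn; have [lh _] := fanni_bounded (of_real h).
  rewrite (IHn v vn) (linearfunD lh) (linearfunZ _ lh) fanni_vacuum scaler0 add0r.
  rewrite linearfun_sum//; apply: eq_bigr => z _.
  by rewrite (linearfunZ _ lh) fanni_fcrea scalerA.
(* Recursion for the moments: [h] is contracted with some later letter, and the subwords between and
   after the two contribute separately. The creation part of S(h) drops out because its adjoint
   kills the vacuum. *)
have tauE v : (size v < n)%N -> wtau (h :: v) =
    \sum_(z <- cuts v) wtau z.1.1 * (rdot h z.1.2)%:C * wtau z.2.
  move=> vn; rewrite /wtau /tau /= /semicirc innerDl (fanni_adjoint _).
  rewrite fanni_vacuum (innerC _ 0) {1}/inner linear0l conjC0 add0r anniE//.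
  by rewrite inner_suml; apply: eq_bigr => z _; rewrite innerZl.
rewrite big_cons big_map /= wtau_nil scale1r addrCA; congr (_ + _).
rewrite anniE// tauE// scaler_suml.
under [X in _ + X]eq_big_seq => z zw.
  rewrite tauE; last first.
    exact: leq_ltn_trans (leq_addr _ _) (ltn_trans (size_cuts zw) wn).
  rewrite scaler_suml; over.
(* [h] is contracted with [k], and [k'] is the first free letter. Marking [k] before [k'] turns the
   inner sum into the expansion of the word after [k], to which the induction hypothesis applies. *)
rewrite -[X in _ = _ + X](big_cuts_cuts (fun u k u' k' v' =>
  (wtau u * (rdot h k)%:C * wtau u') *: fcrea (of_real k') (wop v' O))).
rewrite -big_split /=; apply: eq_big_seq => z zw.
rewrite (IHn z.2); last first.
  exact: leq_ltn_trans (leq_addl _ _) (ltn_trans (size_cuts zw) wn).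
rewrite scalerDr scalerA; congr (_ + _); rewrite scaler_sumr.
by apply: eq_bigr => y _; rewrite scalerA.
Qed.

End fock_space.

(** * Chaos decomposition of polynomials and of their iterated derivatives *)

Section chaos_expansion.
Context (R : realType) (Fk : fock R).
Local Open Scope ring_scope.
Local Open Scope complex_scope.
Local Notation wop := (@word_op R Fk).
Local Notation pop := (@pol_op R Fk).
Local Notation O := (vacuum Fk).
Implicit Types (w : word R) (P : pol R) (E : seq (R[i] * word R)).

(* A list of pairs (c, [:: h1; ..; hn]) stands for the sum of the
   c h1 (x) .. (x) hn, as a vector of the Fock space ([fockv]) and as a function
   of (t1, .., tn) ([kernel]). *)
Definition fockv E : Fk := \sum_(y <- E) y.1 *: ftens Fk [seq of_real h | h <- y.2].

Definition kernel E (t : seq R) : R[i] :=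
  \sum_(y <- E) y.1 * (\prod_(p <- zip y.2 t) p.1 p.2)%:C.

(** The terms tau(w_0) .. tau(w_n) h_i1 (x) .. (x) h_in given by [n] successive cuts. Only the last
    factor is cut again, as in [nabla_last]. *)
Fixpoint word_chaos (n : nat) w : seq (R[i] * word R) :=
  if n is n'.+1 then
    [seq (wtau Fk z.1.1 * y.1, z.1.2 :: y.2) | z <- cuts w, y <- word_chaos n' z.2]
  else [:: (wtau Fk w, [::])].

Definition pol_chaos (n : nat) P : seq (R[i] * word R) :=
  [seq (p.1 * y.1, y.2) | p <- P, y <- word_chaos n p.2].

Definition pol_size P : nat := \max_(p <- P) size p.2.

Lemma size_word_chaos n w y : y \in word_chaos n w -> size y.2 = n.
Proof.
elim: n w y => [|n IHn] w y /=; first by rewrite inE => /eqP ->.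
by move=> /allpairsPdep[z [x [_ /IHn xn ->]]] /=; rewrite xn.
Qed.

Lemma size_pol_chaos n P y : y \in pol_chaos n P -> size y.2 = n.
Proof. by move=> /allpairsPdep[p [x [_ /size_word_chaos xn ->]]]. Qed.

(** In [word_vacuum] the first term is the degree 0 component, and each creation operator raises by
    one the degrees in the expansion of a strictly shorter suffix. *)
Lemma word_chaosE N w : (size w <= N)%N ->
  wop w O = \sum_(n < N.+1) fockv (word_chaos n w).
Proof.
elim: N w => [|N IHN] w wN.
  rewrite big_ord_recl big_ord0 addr0 /fockv big_seq1 /=.
  by case: w wN => // _; rewrite wtau_nil scale1r.
rewrite word_vacuum big_ord_recl {1}/fockv big_seq1 /=; congr (_ + _).
rewrite /bump /= (eq_bigr (fun n : 'I_N.+1 => \sum_(z <- cuts w)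
    wtau Fk z.1.1 *: fcrea (of_real z.1.2) (fockv (word_chaos n z.2)))); last first.
  move=> n _; rewrite /fockv big_allpairs_dep; apply: eq_bigr => z _.
  have [lz _] := @fcrea_bounded _ Fk (of_real z.1.2).
  rewrite (linearfun_sum _ _ lz) scaler_sumr; apply: eq_bigr => y _ /=.
  by rewrite (linearfunZ _ lz) fcreaE scalerA.
rewrite exchange_big /=; apply: eq_big_seq => z /size_cuts zw.
have [lz _] := @fcrea_bounded _ Fk (of_real z.1.2).
rewrite -scaler_sumr -(linearfun_sum _ _ lz) -IHN//.
by rewrite -ltnS (leq_trans (leq_ltn_trans (leq_addl _ _) zw)).
Qed.

Lemma pol_chaosE N P : (pol_size P <= N)%N ->
  pop P O = \sum_(n < N.+1) fockv (pol_chaos n P).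
Proof.
move=> PN; rewrite /pol_op (eq_bigr (fun n : 'I_N.+1 =>
    \sum_(p <- P) p.1 *: fockv (word_chaos n p.2))); last first.
  move=> n _; rewrite /fockv big_allpairs_dep; apply: eq_bigr => p _.
  by rewrite scaler_sumr; apply: eq_bigr => y _ /=; rewrite scalerA.
rewrite exchange_big /=; apply: eq_big_seq => p pP.
rewrite -scaler_sumr -word_chaosE// (leq_trans _ PN)//.
exact: (@leq_bigmax_seq _ P xpredT (fun q => size q.2)).
Qed.

Lemma inner_fockv E E' : inner (fockv E) (fockv E') =
  \sum_(y <- E) \sum_(x <- E') y.1 * Num.conj x.1 *
    (if size y.2 == size x.2 then
      (\prod_(p <- zip y.2 x.2) rdot p.1 p.2)%:C else 0).
Proof.
rewrite inner_suml; apply: eq_bigr => y _; rewrite inner_sumr.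
apply: eq_bigr => x _; rewrite innerZl innerZr mulrA ftensE !size_map.
congr (_ * _); case: ifP => // _.
rewrite rmorph_prod; elim: y.2 x.2 => [|h hs IHhs] [|k ks] /=; rewrite ?big_nil//.
by rewrite !big_cons /= L2dot_of_real IHhs.
Qed.

(** Elementary tensors of different lengths are orthogonal, so the cross terms between degrees
    vanish. *)
Lemma hnorm_pol_vacuum N P : (pol_size P <= N)%N ->
  hnorm (pop P O) ^+ 2 = \sum_(n < N.+1) hnorm (fockv (pol_chaos n P)) ^+ 2.
Proof.
move=> /pol_chaosE ->; rewrite hnorm_sqr inner_suml Re_sum.
apply: eq_bigr => n _; rewrite hnorm_sqr inner_sumr; congr complex.Re.
rewrite (bigD1 n)//= big1 ?addr0// => m mn; rewrite inner_fockv.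
rewrite big_seq big1// => y /size_pol_chaos yn.
rewrite big_seq big1// => x /size_pol_chaos xm.
by rewrite yn xm [(n : nat) == m]eq_sym (negbTE (mn : (m != n :> nat))) mulr0.
Qed.

Lemma nabla_word_cuts (s : R) w :
  nabla_word s w = [seq (((z.1.2 : L2real R) s)%:C, z.1.1, z.2) | z <- cuts w].
Proof.
by elim: w => //= h w ->; rewrite -!map_comp.
Qed.

(** The left side is the trace of the iterated derivative. It is stated for an arbitrary [Z] so that
    the induction on [t] goes through: finished factors contribute their moments, and only the last
    factor remains to be cut. *)
Lemma nabla_formal_chaos (Z : ftensor R) (t : seq R) :
  \sum_(z <- foldl (@nabla_last R) Z t)
     z.1.1 * (\prod_(w <- rcons z.1.2 z.2) wtau Fk w) =
  \sum_(z <- Z) z.1.1 * (\prod_(w <- z.1.2) wtau Fk w) *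
     kernel (word_chaos (size t) z.2) t.
Proof.
elim: t Z => [|s t IHt] Z /=.
  apply: eq_bigr => z _; rewrite /kernel big_seq1 big_nil mulr1.
  by rewrite -cats1 big_cat big_seq1 mulrA.
rewrite IHt /nabla_last big_allpairs_dep; apply: eq_bigr => z _.
rewrite nabla_word_cuts big_map /kernel big_allpairs_dep mulr_sumr.
apply: eq_bigr => x _ /=; rewrite !mulr_sumr; apply: eq_bigr => y _ /=.
rewrite -cats1 big_cat big_seq1 big_cons /= rmorphM /=.
by ring.
Qed.

Lemma kernel_pol_chaos n P t : kernel (pol_chaos n P) t =
  \sum_(p <- P) p.1 * kernel (word_chaos n p.2) t.
Proof.
rewrite /kernel big_allpairs_dep; apply: eq_bigr => p _.
by rewrite mulr_sumr; apply: eq_bigr => y _; rewrite mulrA.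
Qed.

Lemma kernel_pol_sub n P Q t : kernel (pol_chaos n (pol_sub P Q)) t =
  kernel (pol_chaos n P) t - kernel (pol_chaos n Q) t.
Proof.
rewrite !kernel_pol_chaos big_cat big_map /= -sumrN; congr (_ + _).
by apply: eq_bigr => p _; rewrite mulNr.
Qed.

Lemma pol_op_sub P Q u : pop (pol_sub P Q) u = pop P u - pop Q u.
Proof.
rewrite /pol_op big_cat big_map /= -sumrN; congr (_ + _).
by apply: eq_bigr => p _; rewrite scaleNr.
Qed.

End chaos_expansion.

(** * The trace on the tensor powers, and the isometry with the vacuum vectors *)

Section L2_embedding.
Context (R : realType) (Fk : fock R) (L : forall k, tensL2 Fk k).
Local Open Scope ring_scope.
Local Open Scope complex_scope.
Local Notation wop := (@word_op R Fk).
Local Notation pop := (@pol_op R Fk).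
Local Notation O := (vacuum Fk).

Lemma id_SC : SC (idfun : Fk -> Fk).
Proof. exact: word_op_SC [::]. Qed.

(** The isometry of X |-> X Omega, from tau(Y^* X) = <X Omega, Y Omega>. *)
Lemma inner_pol_L2 (P Q : pol R) :
  inner (pol_L2 L P) (pol_L2 L Q) = inner (pop P O) (pop Q O).
Proof.
have [Qstar hQ] := pol_op_adjoint Fk Q.
rewrite (@gtensE _ _ _ _ (fun=> pop P) (fun=> pop Q) (fun=> Qstar))//;
  try by move=> _; exact: pol_op_SC.
by rewrite big_ord1 /tau /= innerC -hQ -innerC.
Qed.

Lemma hnorm_pol_L2 (P Q : pol R) :
  hnorm (pol_L2 L P - pol_L2 L Q) = hnorm (pop (pol_sub P Q) O).
Proof.
rewrite /hnorm; congr (Num.sqrt (complex.Re _)).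
by rewrite pol_op_sub !(innerBl, innerBr) !inner_pol_L2.
Qed.

Lemma hnorm_gtens_id k : hnorm (gtens (L k) (fun=> idfun)) = 1.
Proof.
rewrite /hnorm (@gtensE _ _ _ _ (fun=> idfun) (fun=> idfun) (fun=> idfun))//;
  try by move=> _; exact: id_SC.
by rewrite big1 ?sqrtr1// => i _; exact: (wtau_nil Fk).
Qed.

Lemma tauL2B k (u v : L k) : tauL2 (u - v) = tauL2 u - tauL2 v.
Proof. exact: innerBl. Qed.

Lemma normsq_tauL2_le k (v : L k) : normsq (tauL2 v) <= hnorm v ^+ 2.
Proof. by apply: normsq_inner_le; rewrite hnorm_gtens_id. Qed.

Lemma var_hnorm (F : L 1%N) : var L F = hnorm F ^+ 2 - normsq (tauL2 F).
Proof. by rewrite /var hnorm_sub_unit// hnorm_gtens_id. Qed.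

Lemma tauL2_nablan n (P : pol R) (t : n.-tuple R) :
  tauL2 (nablan L P t) = kernel (pol_chaos Fk n P) t.
Proof.
(* Each derivative adds exactly one factor; this count identifies the product over the [n.+1] slots
   of [gtens] with the product over the list of factors. *)
have formal_size (Z : ftensor R) m (s : seq R) : all (fun z => size z.1.2 == m) Z ->
    all (fun z => size z.1.2 == (m + size s)%N) (foldl (@nabla_last R) Z s).
  elim: s m Z => [|a s IHs] m Z /= hZ; first by rewrite addn0.
  rewrite addnS -addSn; apply: IHs.
  apply/allP => _ /allpairsPdep[x [y [xZ _ ->]]] /=.
  by rewrite size_rcons (eqP (allP hZ _ xZ)).
rewrite /tauL2 /nablan inner_suml kernel_pol_chaos.
transitivity (\sum_(z <- nabla_formal P t)
     z.1.1 * (\prod_(w <- rcons z.1.2 z.2) wtau Fk w)).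
  have : all (fun z => size z.1.2 == n) (nabla_formal P t).
    have := formal_size [seq (p.1, [::], p.2) | p <- P] 0%N t.
    by rewrite size_tuple add0n; apply; rewrite all_map; apply/allP.
  move=> /allP nsz; apply: eq_big_seq => z /nsz /eqP zn.
  rewrite innerZl (@gtensE _ _ _ _ _ (fun=> idfun) (fun=> idfun))//;
    try by move=> i; first [exact: id_SC | exact: word_op_SC].
  congr (_ * _); rewrite (big_nth [::]) size_rcons zn big_mkord.
  by [].
rewrite nabla_formal_chaos big_map size_tuple.
by apply: eq_bigr => p _; rewrite big_nil mulr1.
Qed.

End L2_embedding.

(** * Integrals of products of functions of separate variables *)

Section product_integral.
Local Open Scope classical_set_scope.
Local Open Scope ring_scope.
Context d1 d2 (T1 : measurableType d1) (T2 : measurableType d2) (R : realType).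
Variables (m1 : {sigma_finite_measure set T1 -> \bar R}).
Variables (m2 : {sigma_finite_measure set T2 -> \bar R}).
Variables (f : T1 -> R) (g : T2 -> R).
Hypothesis intf : m1.-integrable setT (EFin \o f).
Hypothesis intg : m2.-integrable setT (EFin \o g).

Let fg (z : T1 * T2) : \bar R := (f z.1 * g z.2)%:E.

Let measurable_fg : measurable_fun setT fg.
Proof.
have /measurable_EFinP mf := measurable_int _ intf.
have /measurable_EFinP mg := measurable_int _ intg.
apply/measurable_EFinP; apply: measurable_funM.
  exact: measurableT_comp mf measurable_fst.
exact: measurableT_comp mg measurable_snd.
Qed.

Lemma integrable_prod_mul : (m1 \x m2)%E.-integrable setT fg.
Proof.
apply/integrable12ltyP => //.
rewrite (eq_integral (fun x => (fine (\int[m2]_y `|(g y)%:E|))%:E * `|(f x)%:E|)%E).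
  rewrite ge0_integralZl//.
  - apply: lte_mul_pinfty => //; last by case/integrableP: intf.
    by rewrite lee_fin fine_ge0// integral_ge0.
  - by apply: measurableT_comp => //; exact: measurable_int intf.
  - by rewrite lee_fin fine_ge0// integral_ge0.
move=> x _; rewrite fineK; last by apply/integrable_fin_num/integrable_abse.
rewrite muleC -ge0_integralZl//.
  by apply: eq_integral => y _; rewrite /fg /= normrM EFinM.
by apply: measurableT_comp => //; exact: measurable_int intg.
Qed.

Lemma Rintegral_prod_mul :
  (\int[(m1 \x m2)%E]_z (f z.1 * g z.2) = \int[m1]_x f x * \int[m2]_y g y)%R.
Proof.
rewrite [LHS](congr1 fine (esym (integral12_prod_meas1 integrable_prod_mul))).
rewrite /fubini_F /Rintegral -fineM ?integrable_fin_num//; congr fine.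
have gfin : (\int[m2]_y (g y)%:E)%E \is a fin_num by exact: integrable_fin_num.
rewrite muleC -[X in (X * _)%E](fineK gfin) -integralZl//; apply: eq_integral => x _.
by rewrite fineK// muleC -integralZl.
Qed.

End product_integral.

(** * Lebesgue measure on tuples and integrals of elementary tensors *)

Section lebesgue_tuple.
Local Open Scope classical_set_scope.
Local Open Scope ring_scope.
Local Open Scope complex_scope.
Context (R : realType).
Local Notation mR := (measurableTypeR R).

(** [lebn] is only typed as a measure; the product theorems need the sigma-finite structure, which
    is packed here from a proof. *)
Definition sigma_finite_measure_of d (T : measurableType d)
    (m : {measure set T -> \bar R}) (sfm : sigma_finite setT m) :
    {sigma_finite_measure set T -> \bar R} :=
  HB.pack_for (SigmaFiniteMeasure.type T R) (Measure.sort m)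
    (isSFinite.Build _ _ _ _ (sfinite_measure_sigma_finite sfm))
    (isSigmaFinite.Build _ _ _ _ sfm).

Lemma measurable_tcons n : measurable_fun setT (@tcons R n).
Proof. by apply: measurable_cons. Qed.

Lemma sigma_finite_leb_cons n (m : {sigma_finite_measure set (n.-tuple mR) -> \bar R}) :
  sigma_finite setT (leb_cons m).
Proof.
have /sigma_finiteP[F [FT ndF mF]] := sigma_finiteT m.
have /sigma_finiteP[G [GT ndG mG]] := sigma_finiteT (leb R).
pose uncons (t : n.+1.-tuple mR) : n.-tuple mR * mR := ([tuple of behead t], thead t).
have unconsK p : uncons (tcons p) = p.
  by case: p => p x; congr pair; apply/val_inj.
have munc : measurable_fun setT uncons.
  apply: measurable_fun_pair; first exact: measurable_behead.
  exact: measurable_tnth.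
exists (fun i => uncons @^-1` (F i `*` G i)).
  rewrite -preimage_bigcup; apply/esym; rewrite -subTset => t _.
  have [[i _ Fi] [j _ Gj]] : (\bigcup_i F i) (uncons t).1 /\ (\bigcup_i G i) (uncons t).2.
    by rewrite -FT -GT.
  (* Both exhaustions are nondecreasing, so a single index serves for the two coordinates. *)
  exists (maxn i j) => //; split.
    by apply: (subsetPset _ _ (ndF _ _ (leq_maxl i j))).
  by apply: (subsetPset _ _ (ndG _ _ (leq_maxr i j))).
move=> i; have [mFi Fi] := mF i; have [mGi Gi] := mG i; split.
  by rewrite -[X in measurable X]setTI; apply: munc => //; exact: measurableX.
rewrite /leb_cons /pushforward -comp_preimage (_ : uncons \o _ = id)//.
  by rewrite preimage_id product_measure1E// lte_mul_pinfty// ge0_fin_numE.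
by rewrite funeqE.
Qed.

Lemma sigma_finite_lebn n : sigma_finite setT (lebn R n).
Proof.
elim: n => [|n IHn] /=.
  by apply: fin_num_fun_sigma_finite => //; rewrite ?measure0.
pose m : {sigma_finite_measure set (n.-tuple mR) -> \bar R} :=
  sigma_finite_measure_of IHn.
exact: (sigma_finite_leb_cons m).
Qed.

(** The factors are plain functions: [tens] is also applied to pointwise products of two
    square-integrable functions, for which only integrability is known. *)
Definition tens (hs : seq (mR -> R)) (t : seq R) : R := \prod_(p <- zip hs t) p.1 p.2.

Lemma measurable_tens n (hs : seq (mR -> R)) : size hs = n ->
  (forall i, (i < n)%N -> measurable_fun setT (nth (fun=> 0) hs i)) ->
  measurable_fun setT (fun t : n.-tuple mR => tens hs t).
Proof.
move=> hsn mhs; rewrite (_ : (fun t => _) = fun t : n.-tuple mR =>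
    \prod_(i < n) nth (fun=> 0) hs i (tnth t i)); last first.
  apply/funext => t; rewrite /tens (big_nth (fun=> 0, 0)).
  rewrite size_zip hsn size_tuple minnn big_mkord; apply: eq_bigr => i _.
  by rewrite nth_zip ?size_tuple//= (tnth_nth 0).
apply: measurable_prod => i _; apply: measurableT_comp; first exact: mhs.
exact: measurable_tnth.
Qed.

(** Induction on [n]: pulled back along [tcons], the integrand separates into the head factor and
    the remaining ones. For [n = 0] the measure is a unit mass and the integrand is the empty
    product 1. *)
Lemma integral_tens n (hs : seq (mR -> R)) : size hs = n ->
  (forall i, (i < n)%N -> (leb R).-integrable setT (EFin \o nth (fun=> 0) hs i)) ->
  (lebn R n).-integrable setT (fun t => (tens hs t)%:E) /\
  \int[lebn R n]_t tens hs t = \prod_(h <- hs) \int[leb R]_x h x.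
Proof.
elim: n hs => [|n IHn] hs.
  case: hs => // _ _; split => /=.
    rewrite (_ : (fun t => _) = cst 1%E).
      exact: finite_measure_integrable_cst.
    by apply/funext => t; rewrite /tens big1_seq// => p; case: (tval t).
  rewrite /Rintegral (eq_integral (cst 1%E)).
    by rewrite integral_dirac// diracE in_setT mule1 big_nil.
  by move=> t _; rewrite /tens big1_seq// => p; case: (tval t).
case: hs => // h hs [hsn] inth.
have inth0 := inth 0%N (ltn0Sn n).
have [intG eqG] := IHn hs hsn (fun i ni => inth i.+1 ni).
pose m : {sigma_finite_measure set (n.-tuple mR) -> \bar R} :=
  sigma_finite_measure_of (sigma_finite_lebn n).
have mten : measurable_fun setT (fun t : n.+1.-tuple mR => tens (h :: hs) t).
  apply: measurable_tens => [|i ni]; first by rewrite /= hsn.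
  by have /measurable_EFinP := measurable_int _ (inth i ni).
have tcE : (fun t : n.+1.-tuple mR => (tens (h :: hs) t)%:E) \o @tcons R n =
    fun p => (tens hs p.1 * h p.2)%:E.
  by apply/funext => p /=; rewrite /tens /= big_cons /= mulrC.
have intp : (m \x leb R)%E.-integrable setT
    ((fun t : n.+1.-tuple mR => (tens (h :: hs) t)%:E) \o @tcons R n).
  by rewrite tcE; exact: (@integrable_prod_mul _ _ _ _ _ m (leb R) (fun t => tens hs t) h).
have mE : measurable_fun setT (fun t : n.+1.-tuple mR => (tens (h :: hs) t)%:E).
  exact/measurable_EFinP.
split.
  exact: (integrable_pushforward (@measurable_tcons n) mE intp measurableT).
rewrite {1}/Rintegral.
rewrite (integral_pushforward (@measurable_tcons n) mE intp measurableT).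
rewrite tcE preimage_setT big_cons -eqG mulrC.
exact: (@Rintegral_prod_mul _ _ _ _ _ m (leb R) (fun t => tens hs t) h).
Qed.

End lebesgue_tuple.

(** * Isometry between kernels and Fock vectors *)

Section kernel_isometry.
Local Open Scope classical_set_scope.
Local Open Scope ring_scope.
Local Open Scope complex_scope.
Context (R : realType) (Fk : fock R).
Local Notation mR := (measurableTypeR R).
Implicit Types (h k : L2real R) (E : seq (R[i] * word R)).

Lemma measurable_L2real h : measurable_fun setT (h : mR -> R).
Proof. by have := LfunP h; rewrite inE => /andP[]; rewrite inE. Qed.

Lemma integrable_L2real_mul h k :
  (leb R).-integrable setT (EFin \o (fun s : mR => h s * k s)).
Proof. exact/Lfun1_integrable/(Lfun2_mul_Lfun1 (LfunP h) (LfunP k)). Qed.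

Lemma prod_zip_tens (w : word R) (t : seq R) :
  \prod_(p <- zip w t) p.1 p.2 = tens [seq (h : mR -> R) | h <- w] t.
Proof.
rewrite /tens; elim: w t => [|h w IHw] [|s t] /=; rewrite ?big_nil//.
by rewrite !big_cons IHw.
Qed.

Lemma measurable_kernel_term n (w : word R) : size w = n ->
  measurable_fun setT (fun t : n.-tuple mR => \prod_(p <- zip w t) p.1 p.2).
Proof.
move=> wn; under eq_fun do rewrite prod_zip_tens.
apply: measurable_tens => [|i ni]; first by rewrite size_map.
by rewrite (nth_map 0) ?wn//; exact: measurable_L2real.
Qed.

Lemma measurable_Re_kernel n E : (forall y, y \in E -> size y.2 = n) ->
  measurable_fun setT (fun t : n.-tuple mR => complex.Re (kernel E t)).
Proof.
move=> En; rewrite (_ : (fun t => _) = fun t : n.-tuple mR =>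
    \sum_(i < size E) complex.Re (tnth (in_tuple E) i).1 *
      \prod_(p <- zip (tnth (in_tuple E) i).2 t) p.1 p.2); last first.
  apply/funext => t; rewrite /kernel Re_sum (@big_tnth _ _ _ _ E).
  by apply: eq_bigr => i _; rewrite ReMr.
apply: measurable_sum => i; apply: measurable_funM => //.
by apply: measurable_kernel_term; exact: (En _ (mem_tnth _ (in_tuple E))).
Qed.

Lemma measurable_Im_kernel n E : (forall y, y \in E -> size y.2 = n) ->
  measurable_fun setT (fun t : n.-tuple mR => complex.Im (kernel E t)).
Proof.
move=> En; rewrite (_ : (fun t => _) = fun t : n.-tuple mR =>
    \sum_(i < size E) complex.Im (tnth (in_tuple E) i).1 *
      \prod_(p <- zip (tnth (in_tuple E) i).2 t) p.1 p.2); last first.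
  apply/funext => t; rewrite /kernel Im_sum big_tnth.
  by apply: eq_bigr => i _; rewrite ImMr.
apply: measurable_sum => i; apply: measurable_funM => //.
by apply: measurable_kernel_term; exact: (En _ (mem_tnth _ (in_tuple E))).
Qed.

Lemma normsq_kernel E (t : seq R) : normsq (kernel E t) =
  \sum_(y <- E) \sum_(x <- E) complex.Re (y.1 * Num.conj x.1) *
    (\prod_(p <- zip y.2 t) p.1 p.2 * \prod_(p <- zip x.2 t) p.1 p.2).
Proof.
have -> : normsq (kernel E t) = complex.Re (kernel E t * Num.conj (kernel E t)).
  by rewrite mul_conj.
rewrite {1}/kernel mulr_suml Re_sum; apply: eq_bigr => y _.
rewrite /kernel rmorph_sum mulr_sumr Re_sum; apply: eq_bigr => x _ /=.
by rewrite rmorphM /= conj_real mulrACA -rmorphM ReMr.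
Qed.

(** The product of two elementary tensors is the elementary tensor of the pointwise products, each
    integrable by Hölder. *)
Lemma integral_prod_zip n (w w' : word R) : size w = n -> size w' = n ->
  (lebn R n).-integrable setT (fun t : n.-tuple mR =>
    (\prod_(p <- zip w t) p.1 p.2 * \prod_(p <- zip w' t) p.1 p.2)%:E) /\
  \int[lebn R n]_t (\prod_(p <- zip w t) p.1 p.2 * \prod_(p <- zip w' t) p.1 p.2) =
    \prod_(p <- zip w w') rdot p.1 p.2.
Proof.
move=> wn w'n; pose ms :=
  [seq (fun s : mR => (p.1 : L2real R) s * (p.2 : L2real R) s) | p <- zip w w'].
have szms : size ms = n by rewrite size_map size_zip wn w'n minnn.
have msE (t : n.-tuple mR) :
    \prod_(p <- zip w t) p.1 p.2 * \prod_(p <- zip w' t) p.1 p.2 = tens ms t.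
  rewrite /tens /ms {ms szms}; move: wn w'n; rewrite -{1 2}(size_tuple t).
  elim: (tval t) w w' => [|s t' IHt] [|h w] [|k w'] //=.
    by rewrite !big_nil mulr1.
  by move=> [wn] [w'n]; rewrite !big_cons mulrACA IHt.
have [||intms eqms] := @integral_tens R n ms => //.
  move=> i ni; rewrite (nth_map (0, 0)) ?size_zip ?wn ?w'n ?minnn//.
  exact: integrable_L2real_mul.
split; first by under eq_fun do rewrite msE.
by under eq_Rintegral do rewrite msE; rewrite eqms big_map.
Qed.

(** Both squared norms expand into the same double sum of coefficients times products of [rdot]; as
    all terms have length [n], every pair contributes to the Fock inner product. *)
Lemma integral_normsq_kernel n E : (forall y, y \in E -> size y.2 = n) ->
  (\int[lebn R n]_t (normsq (kernel E t))%:E)%E = (hnorm (fockv Fk E) ^+ 2)%:E.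
Proof.
move=> En; pose e := tnth (in_tuple E).
have en i : size (e i).2 = n by exact: (En _ (mem_tnth _ (in_tuple E))).
pose F i j (t : n.-tuple mR) := complex.Re ((e i).1 * Num.conj (e j).1) *
  (\prod_(p <- zip (e i).2 t) p.1 p.2 * \prod_(p <- zip (e j).2 t) p.1 p.2).
have intF i j : (lebn R n).-integrable setT (EFin \o F i j).
  rewrite (_ : EFin \o _ = fun t : n.-tuple mR =>
    ((complex.Re ((e i).1 * Num.conj (e j).1))%:E *
    (\prod_(p <- zip (e i).2 t) p.1 p.2 * \prod_(p <- zip (e j).2 t) p.1 p.2)%:E)%E)//.
  by apply: integrableZl => //; have [] := integral_prod_zip (en i) (en j).
rewrite (eq_integral (fun t =>
    (\sum_(i < size E) \sum_(j < size E) (F i j t)%:E)%E)); last first.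
  move=> t _; rewrite normsq_kernel big_tnth -sumEFin; apply: eq_bigr => i _.
  by rewrite (@big_tnth _ _ _ _ E) -sumEFin.
rewrite integral_sum//; last first.
  by move=> i; apply: integrable_sum => // j _; exact: intF.
rewrite hnorm_sqr inner_fockv Re_sum (@big_tnth _ _ _ _ E) -sumEFin; apply: eq_bigr => i _.
rewrite integral_sum//; last exact: intF.
rewrite Re_sum (@big_tnth _ _ _ _ E) -sumEFin; apply: eq_bigr => j _.
rewrite -/e !en eqxx ReMr.
have [intij <-] := integral_prod_zip (en i) (en j).
by rewrite EFinM /Rintegral fineK ?integrable_fin_num// -integralZl.
Qed.

End kernel_isometry.

(** * Square integrals of complex functions of several variables *)

Section square_integrals.
Local Open Scope classical_set_scope.
Local Open Scope ring_scope.
Local Open Scope complex_scope.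
Context (R : realType).
Local Notation mR := (measurableTypeR R).

Definition cmeasurable n (f : n.-tuple mR -> R[i]) :=
  measurable_fun setT (fun t => complex.Re (f t)) /\
  measurable_fun setT (fun t => complex.Im (f t)).

Definition intsq n (f : n.-tuple mR -> R[i]) : \bar R :=
  (\int[lebn R n]_t (normsq (f t))%:E)%E.

Lemma cmeasurableB n (f g : n.-tuple mR -> R[i]) :
  cmeasurable f -> cmeasurable g -> cmeasurable (fun t => f t - g t).
Proof.
move=> [rf imf] [rg img]; split.
  by under eq_fun do rewrite ReD ReN; exact: measurable_funB.
by under eq_fun do rewrite ImD ImN; exact: measurable_funB.
Qed.

Lemma measurable_normsq n (f : n.-tuple mR -> R[i]) : cmeasurable f ->
  measurable_fun setT (fun t => (normsq (f t))%:E).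
Proof.
by move=> [rf imf]; apply/measurable_EFinP; apply: measurable_funD;
  exact: measurable_funX.
Qed.

Lemma intsq_ge0 n (f : n.-tuple mR -> R[i]) : (0 <= intsq f)%E.
Proof. by apply: integral_ge0 => t _; rewrite lee_fin normsq_ge0. Qed.

Lemma intsqC n (f g : n.-tuple mR -> R[i]) :
  intsq (fun t => f t - g t) = intsq (fun t => g t - f t).
Proof. by apply: eq_integral => t _; rewrite -normsqN opprB. Qed.

Lemma intsqD_le n (e : R) (f g : n.-tuple mR -> R[i]) : 0 < e ->
  cmeasurable f -> cmeasurable g ->
  (intsq (fun t => f t + g t)%R <= (1 + e)%:E * intsq f + (1 + e^-1)%:E * intsq g)%E.
Proof.
move=> e0 mf mg.
have e1 : 0 <= 1 + e by rewrite addr_ge0// ltW.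
have e2 : 0 <= 1 + e^-1 by rewrite addr_ge0// invr_ge0 ltW.
rewrite /intsq -!ge0_integralZl//; try exact: measurable_normsq;
  try by move=> t _; rewrite lee_fin normsq_ge0.
rewrite -ge0_integralD//; first last.
- by apply: measurable_funeM; exact: measurable_normsq.
- by move=> t _; rewrite mule_ge0// lee_fin normsq_ge0.
- by apply: measurable_funeM; exact: measurable_normsq.
- by move=> t _; rewrite mule_ge0// lee_fin normsq_ge0.
apply: ge0_le_integral => //.
- by move=> t _; rewrite lee_fin normsq_ge0.
- apply: (@measurable_normsq _ (fun t => f t + g t)); case: mf mg => [rf imf] [rg img]; split.
    by under eq_fun do rewrite ReD; exact: measurable_funD.
  by under eq_fun do rewrite ImD; exact: measurable_funD.
- by apply: emeasurable_funD; apply: measurable_funeM; exact: measurable_normsq.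
- by move=> t _; rewrite -!EFinM -EFinD lee_fin normsqD_le.
Qed.

(** [intsqD_le] summed over a window of degrees. Measurability is asked only from degree [m] on,
    because the limit kernels are controlled only in degrees at least 1. *)
Lemma sum_intsqD_le (e a b : R) m M (u v w : forall n, n.-tuple mR -> R[i]) :
  0 < e ->
  (forall n, (m <= n)%N -> cmeasurable (v n)) ->
  (forall n, (m <= n)%N -> cmeasurable (w n)) ->
  (forall n t, u n t = v n t + w n t) ->
  (\sum_(m <= n < M) intsq (v n) <= a%:E)%E ->
  (\sum_(m <= n < M) intsq (w n) <= b%:E)%E ->
  (\sum_(m <= n < M) intsq (u n) <= ((1 + e) * a + (1 + e^-1) * b)%:E)%E.
Proof.
move=> e0 mv mw uE va wb.
have e1 : 0 <= 1 + e by rewrite addr_ge0// ltW.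
have e2 : 0 <= 1 + e^-1 by rewrite addr_ge0// invr_ge0 ltW.
apply: (@le_trans _ _ (\sum_(m <= n < M)
    ((1 + e)%:E * intsq (v n) + (1 + e^-1)%:E * intsq (w n)))%E).
  rewrite big_nat [leRHS]big_nat; apply: lee_sum => n /andP[mn _].
  rewrite (_ : intsq (u n) = intsq (fun t => v n t + w n t)).
    by apply: intsqD_le => //; [exact: mv|exact: mw].
  by congr intsq; apply/funext.
rewrite big_split /= [leRHS]EFinD !EFinM -!ge0_sume_distrr;
  try by move=> n _; exact: intsq_ge0.
by rewrite leeD// lee_wpmul2l.
Qed.

(* Unlike [ge0_le_integral], asks for no measurability: the norm of a
   vector-valued map is bounded below without showing it measurable. *)
Lemma ge0_le_integral_pointwise n (f g : n.-tuple mR -> \bar R) :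
  (forall t, 0 <= f t)%E -> (forall t, f t <= g t)%E ->
  (\int[lebn R n]_t f t <= \int[lebn R n]_t g t)%E.
Proof.
move=> f0 fg; have g0 t := le_trans (f0 t) (fg t).
rewrite !ge0_integralTE//; apply: ereal_sup_le => _ [h hf <-].
by exists h => // t; exact: le_trans (hf t) (fg t).
Qed.

End square_integrals.

(** * Measurability of the trace of a Bochner measurable map *)

Section strong_measurability.
Local Open Scope classical_set_scope.
Local Open Scope ring_scope.
Local Open Scope complex_scope.
Context (R : realType) (Fk : fock R) (L : forall k, tensL2 Fk k).
Local Notation mR := (measurableTypeR R).

(** Every preimage is a finite union of fibres of [s], so [V] carries no measurable structure and
    [phi] is arbitrary. *)
Lemma measurable_simple_comp d (T : measurableType d) (V : Type) (s : T -> V) (phi : V -> R) :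
  finite_set (range s) -> (forall v, measurable (s @^-1` [set v])) ->
  measurable_fun setT (phi \o s).
Proof.
move=> fs ms _ B mB; rewrite setTI.
rewrite (_ : _ @^-1` B = \bigcup_(v in range s `&` (phi @^-1` B)) s @^-1` [set v]).
  apply: fin_bigcup_measurable => //; exact: finite_setIl.
apply/seteqP; split=> [t Bt|t [v [_ Bv] stv]]; last by rewrite /= stv.
by exists (s t) => //; split => //; exists t.
Qed.

(** The traces of the simple approximants are measurable and converge pointwise, since the trace is
    a contraction. The argument is made once for a generic [part], then used for the real and the
    imaginary part. *)
Lemma cmeasurable_tauL2 n (Y : n.-tuple R -> L n.+1) : strongly_measurable L Y ->
  cmeasurable (fun t : n.-tuple mR => tauL2 (Y t)).
Proof.
move=> [s [fs ms sY]].
have lim_part (part : R[i] -> R) :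
    (forall x y, part (x - y) = part x - part y) ->
    (forall x, part x ^+ 2 <= normsq x) ->
    measurable_fun setT (fun t : n.-tuple mR => part (tauL2 (Y t))).
  move=> partB part_le.
  apply: (@measurable_fun_cvg _ _ _ _ (fun m (t : n.-tuple mR) => part (tauL2 (s m t)))).
    move=> m; exact: (@measurable_simple_comp _ (n.-tuple mR) _ (s m) (fun v => part (tauL2 v))
      (fs m) (ms m)).
  move=> t _; apply/cvgrPdist_le => e e0.
  have /cvgrPdist_le /(_ e e0) := sY t; apply: filterS => m.
  rewrite sub0r normrN ger0_norm ?hnorm_ge0// hnorm_distC; apply: le_trans.
  rewrite -partB -tauL2B -(@ler_pXn2r _ 2)// ?nnegrE ?hnorm_ge0//.
  by rewrite real_normK ?num_real// (le_trans (part_le _))// normsq_tauL2_le.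
split; apply: lim_part => [x y|x].
- by rewrite ReD ReN.
- by rewrite lerDl sqr_ge0.
- by rewrite ImD ImN.
- by rewrite lerDr sqr_ge0.
Qed.

End strong_measurability.

(** * The variance formula for polynomials, and approximation in the graph *)

Section variance.
Local Open Scope classical_set_scope.
Local Open Scope ring_scope.
Local Open Scope complex_scope.
Context (R : realType) (Fk : fock R) (L : forall k, tensL2 Fk k).
Local Notation mR := (measurableTypeR R).
Local Notation pop := (@pol_op R Fk).
Local Notation O := (vacuum Fk).
Implicit Types (P Q : pol R) (u v : L 1%N).

Definition center u : L 1%N := u - tauL2 u *: gtens (L 1%N) (fun=> idfun).

Lemma centerB u v : center (u - v) = center u - center v.
Proof.
rewrite /center tauL2B scalerBl !opprB !addrA addrAC [RHS]addrAC.
by congr (_ + _); rewrite addrAC.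
Qed.

Lemma var_le u : var L u <= hnorm u ^+ 2.
Proof. by rewrite var_hnorm gerBl normsq_ge0. Qed.

(** The variance is the squared norm of the additive map [center], and is at most the squared norm
    of the vector itself. *)
Lemma varD_le (e : R) u v : 0 < e ->
  var L u <= (1 + e) * var L v + (1 + e^-1) * hnorm (u - v) ^+ 2.
Proof.
move=> e0; rewrite -[u in var _ u](subrK v) addrC.
have -> : var L (v + (u - v)) = hnorm (center v + center (u - v)) ^+ 2.
  by rewrite centerB addrC subrK addrC subrK.
apply: le_trans (hnormD_sqr_le _ _ e0) _; rewrite lerD2l.
by rewrite ler_wpM2l ?var_le// addr_ge0// invr_ge0 ltW.
Qed.

Definition chaos_kernel P n (t : n.-tuple mR) : R[i] := kernel (pol_chaos Fk n P) t.

Lemma cmeasurable_chaos_kernel P n : cmeasurable (@chaos_kernel P n).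
Proof.
split; [apply: measurable_Re_kernel|apply: measurable_Im_kernel];
  exact: size_pol_chaos.
Qed.

Lemma intsq_chaos_kernel P n :
  intsq (@chaos_kernel P n) = (hnorm (fockv Fk (pol_chaos Fk n P)) ^+ 2)%:E.
Proof. by apply: integral_normsq_kernel; exact: size_pol_chaos. Qed.

Lemma normsq_tauL2_pol P :
  normsq (tauL2 (pol_L2 L P)) = hnorm (fockv Fk (pol_chaos Fk 0 P)) ^+ 2.
Proof.
have -> : tauL2 (pol_L2 L P) = kernel (pol_chaos Fk 0 P) [::].
  rewrite /tauL2 /pol_L2 (@gtensE _ _ _ _ (fun=> pop P) (fun=> idfun) (fun=> idfun))//;
    try by move=> _; first [exact: pol_op_SC|exact: id_SC].
  rewrite big_ord1 /tau /= /pol_op inner_suml kernel_pol_chaos.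
  apply: eq_bigr => p _; rewrite innerZl /kernel big_seq1 big_nil mulr1.
  by [].
(* In degree 0 the measure is the unit mass at the empty tuple, so the isometry of kernels becomes
   an equality of scalars. *)
have := intsq_chaos_kernel P 0; rewrite /intsq /=
  (eq_integral (cst (normsq (kernel (pol_chaos Fk 0 P) [::]))%:E)).
  by rewrite integral_dirac// diracE in_setT mul1e => h; exact: EFin_inj h.
by move=> t _; rewrite /chaos_kernel tuple0.
Qed.

(** Subtracting the squared trace removes exactly the degree 0 term of [hnorm_pol_vacuum]. *)
Lemma sum_chaos_kernel P N : (pol_size P <= N)%N ->
  (\sum_(1 <= n < N.+1) intsq (@chaos_kernel P n) = (var L (pol_L2 L P))%:E)%E.
Proof.
move=> PN; rewrite var_hnorm normsq_tauL2_pol {1}/hnorm inner_pol_L2 -/(hnorm _).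
rewrite (hnorm_pol_vacuum _ PN) big_ord_recl addrC addKr -sumEFin.
rewrite big_add1 /= big_mkord; apply: eq_bigr => n _.
exact: intsq_chaos_kernel.
Qed.

Lemma sum_chaos_kernel_le P N :
  (\sum_(1 <= n < N.+1) intsq (@chaos_kernel P n) <= (var L (pol_L2 L P))%:E)%E.
Proof.
rewrite -(@sum_chaos_kernel P (N + pol_size P)) ?leq_addl//.
rewrite [leRHS](@big_cat_nat _ _ _ N.+1)//= ?ltnS ?leq_addr//.
by rewrite leeDl// sume_ge0// => n _; exact: intsq_ge0.
Qed.

Lemma sum_chaos_kernelB_le P Q N :
  (\sum_(1 <= n < N.+1) intsq (fun t => @chaos_kernel P n t - @chaos_kernel Q n t)%R
    <= (hnorm (pol_L2 L P - pol_L2 L Q) ^+ 2)%:E)%E.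
Proof.
under eq_bigr => n _.
  under [X in intsq X]eq_fun do rewrite -kernel_pol_sub.
  over.
apply: le_trans (sum_chaos_kernel_le (pol_sub P Q) N) _.
by rewrite lee_fin (le_trans (var_le _))// hnorm_pol_L2 {1}/hnorm inner_pol_L2.
Qed.

(** A late term of the sequence given by the graph closure works for both estimates: the trace,
    being a contraction, carries the convergence of the derivatives over to the kernels. *)
Lemma pol_L2_dense F n (Y : n.-tuple R -> L n.+1) (e : R) : closed_nablan L F Y -> 0 < e ->
  exists P, hnorm (pol_L2 L P - F) ^+ 2 < e /\
    (intsq (fun t => @chaos_kernel P n t - tauL2 (Y t))%R <= e%:E)%E.
Proof.
move=> [_ [P [PF PY]]] e0.
have e1 : 0 < Num.sqrt e by rewrite sqrtr_gt0.
have : \forall m \near \oo, hnorm (pol_L2 L (P m) - F) < Num.sqrt e.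
  have /cvgrPdist_lt /(_ _ e1) := PF; apply: filterS => m.
  by rewrite sub0r normrN ger0_norm ?hnorm_ge0.
have : \forall m \near \oo, (M2normsq L (fun t => nablan L (P m) t - Y t)%R < e%:E)%E.
  have e0' : (0 < e%:E)%E by rewrite lte_fin.
  exact: (PY _ (open_ereal_lt' e0')).
move=> nearY nearF; near \oo => m; exists (P m); split.
  rewrite -(sqr_sqrtr (ltW e0)) ltr_pXn2r ?nnegrE ?hnorm_ge0 ?ltW//.
  by near: m.
apply: (@le_trans _ _ (M2normsq L (fun t => nablan L (P m) t - Y t)%R)); last first.
  by apply: ltW; near: m.
apply: ge0_le_integral_pointwise => t; first by rewrite lee_fin normsq_ge0.
by rewrite lee_fin /chaos_kernel -(tauL2_nablan L) -tauL2B normsq_tauL2_le.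
Unshelve. all: by end_near.
Qed.

End variance.

(** * Passage of the formula from polynomials to the closure *)

Section closure.
Local Open Scope classical_set_scope.
Local Open Scope ring_scope.
Local Open Scope complex_scope.
Context (R : realType) (Fk : fock R) (L : forall k, tensL2 Fk k).
Local Notation mR := (measurableTypeR R).
Variables (F : L 1%N) (Y : forall n, n.-tuple R -> L n.+1).
Hypothesis FY : forall n, (1 <= n)%N -> closed_nablan L F (@Y n).
Implicit Types P Q : pol R.

Let f P n (t : n.-tuple mR) : R[i] := @chaos_kernel R Fk P n t.
Let g n (t : n.-tuple mR) : R[i] := tauL2 (@Y n t).
Let d P : R := hnorm (pol_L2 L P - F) ^+ 2.

Let cmf P n : cmeasurable (@f P n).
Proof. exact: cmeasurable_chaos_kernel. Qed.

Let cmg n : (1 <= n)%N -> cmeasurable (@g n).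
Proof. by move=> /FY[[mY _] _]; exact: cmeasurable_tauL2. Qed.

Let cmfg P n : (1 <= n)%N -> cmeasurable (fun t => @f P n t - @g n t).
Proof. by move=> n1; apply: cmeasurableB; [exact: cmf|exact: cmg]. Qed.

Let dense (e : R) : 0 < e -> exists P, d P < e.
Proof.
by move=> e0; have [P [PF _]] := pol_L2_dense (FY (leqnn 1)) e0; exists P.
Qed.

Let dist_le P Q : hnorm (pol_L2 L P - pol_L2 L Q) ^+ 2 <= 2 * d P + 2 * d Q.
Proof.
rewrite -[pol_L2 L P](subrK F) -addrA.
apply: le_trans (hnormD_sqr_le _ _ ltr01) _.
by rewrite invr1 (hnorm_distC F).
Qed.

(** The approximants of the derivative depend on the degree [n]. Comparing [P] with such an
    approximant [Q] through [sum_chaos_kernelB_le] gives a bound in which [n] no longer appears. *)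
Lemma intsq_sub_le P n : (1 <= n)%N ->
  (intsq (fun t => @f P n t - @g n t)%R <= (4 * d P)%:E)%E.
Proof.
move=> n1; apply/lee_addgt0Pr => e e0; rewrite -EFinD.
(* The total is 2 (2 d(P) + 2 d(Q)) + 2 (e / 6), with d(Q) < e / 6. *)
have e6 : 0 < e / 6 by rewrite divr_gt0.
have [Q [QF QY]] := pol_L2_dense (FY n1) e6.
have := @sum_intsqD_le R 1 (hnorm (pol_L2 L P - pol_L2 L Q) ^+ 2) (e / 6) n n.+1
  (fun n t => @f P n t - @g n t) (fun n t => @f P n t - @f Q n t)
  (fun n t => @f Q n t - @g n t) ltr01.
rewrite !big_nat1 => H; apply: (le_trans (H _ _ _ _ QY)).
- by move=> k _; exact: cmeasurableB.
- by move=> k nk; apply: cmfg; exact: leq_trans nk.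
- by move=> k t; rewrite addrA subrK.
- apply: le_trans (sum_chaos_kernelB_le L P Q n).
  rewrite big_nat_recr//= leeDr// sume_ge0// => k _; exact: intsq_ge0.
- rewrite lee_fin invr1; have := dist_le P Q; move: QF; rewrite -/(d Q); lra.
Qed.

(** The constant 4 must not grow with [N]: the degreewise bound is spent on an auxiliary [Q] very
    close to [F], while the passage from [P] to [Q] is controlled in all degrees at once. *)
Lemma sum_intsq_sub_le P N :
  (\sum_(1 <= n < N.+1) intsq (fun t => @f P n t - @g n t)%R <= (4 * d P)%:E)%E.
Proof.
apply/lee_addgt0Pr => e e0; rewrite -EFinD.
(* The total is 2 (2 d(P) + 2 d(Q)) + 2 N (4 d(Q)) = 4 d(P) + (4 + 8 N) d(Q). *)
have N0 : 0 < 4 + 8 * N%:R :> R by rewrite ltr_pwDl// mulr_ge0.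
have [Q QF] := dense (divr_gt0 e0 N0).
have sumQ : (\sum_(1 <= n < N.+1) intsq (fun t => @f Q n t - @g n t)%R <=
    (N%:R * (4 * d Q))%:E)%E.
  apply: (@le_trans _ _ (\sum_(1 <= n < N.+1) (4 * d Q)%:E)%E).
    rewrite big_nat [leRHS]big_nat; apply: lee_sum => n /andP[n1 _].
    exact: intsq_sub_le.
  by rewrite sumEFin lee_fin sumr_const_nat subn1 -[leLHS]mulr_natl.
apply: le_trans (@sum_intsqD_le R 1 (hnorm (pol_L2 L P - pol_L2 L Q) ^+ 2) _ 1 N.+1
  _ (fun n t => @f P n t - @f Q n t) _ ltr01 _ _ _ _ sumQ) _.
- by move=> k _; exact: cmeasurableB.
- by move=> k k1; exact: cmfg.
- by move=> k t; rewrite addrA subrK.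
- exact: sum_chaos_kernelB_le.
- rewrite lee_fin invr1; have := dist_le P Q.
  move: QF; rewrite ltr_pdivlMr//; lra.
Qed.

Lemma sum_intsq_le_var N : (\sum_(1 <= n < N.+1) intsq (@g n) <= (var L F)%:E)%E.
Proof.
have V0 : 0 <= var L F by exact: sqr_ge0.
(* With V the variance and [e <= 1], the constants come from (1 + e)^2 V <= V + 3 e V, (1 + e)^2 e
   <= 4 e and 4 (1 + e) e <= 8 e. *)
have H (e : R) : 0 < e -> e <= 1 -> (\sum_(1 <= n < N.+1) intsq (@g n) <=
    (var L F + e * (3 * var L F + 12))%:E)%E.
  (* Precision [e ^+ 2] compensates the factor [1 + e^-1], leaving an error of order [e]. *)
  move=> e0 e1; have [P PF] := dense (exprn_gt0 2 e0).
  have sP := @sum_intsq_sub_le P N.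
  apply: le_trans (@sum_intsqD_le R e (var L (pol_L2 L P)) (4 * d P) 1 N.+1
    _ (@f P) (fun n t => @g n t - @f P n t) e0 _ _ _ _ _) _.
  - by move=> k _; exact: cmf.
  - by move=> k k1; apply: cmeasurableB; [exact: cmg|exact: cmf].
  - by move=> k t; rewrite addrC subrK.
  - exact: sum_chaos_kernel_le.
  - by under eq_bigr do rewrite intsqC.
  rewrite lee_fin; have vP := @varD_le _ _ L _ (pol_L2 L P) F e0.
  rewrite -/(d P) in vP.
  have PF' : (1 + e^-1) * d P <= (1 + e) * e.
    rewrite (_ : (1 + e) * e = (1 + e^-1) * e ^+ 2); last by field; rewrite gt_eqF.
    apply: ler_wpM2l; last exact: ltW.
    by rewrite addr_ge0// invr_ge0 ltW.
  have e2 : e * e <= e by rewrite ger_pMl.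
  have : (1 + e) * var L (pol_L2 L P) <= (1 + e) * ((1 + e) * var L F + (1 + e) * e).
    rewrite ler_pM2l ?ltr_pwDl//; last exact: ltW.
    by rewrite (le_trans vP)// lerD2l.
  have : e * e * var L F <= e * var L F by rewrite ler_wpM2r.
  have : e * e * e <= e * e by rewrite ger_pMr// mulr_gt0.
  rewrite (mulrCA _ 4).
  nra.
apply/lee_addgt0Pr => e e0; rewrite -EFinD.
have C0 : 0 < 3 * var L F + 12 by rewrite ltr_wpDl// mulr_ge0.
pose e' := Num.min 1 (e / (3 * var L F + 12)).
have e'0 : 0 < e' by rewrite lt_min ltr01 divr_gt0.
apply: le_trans (H e' e'0 _) _; first by rewrite ge_min lexx.
by rewrite lee_fin lerD2l -ler_pdivlMr// ge_min lexx orbT.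
Qed.

Lemma var_sum_intsq :
  (var L F)%:E = (\sum_(1 <= n <oo) intsq (@g n))%E.
Proof.
have g0 n : (1 <= n)%N -> true -> (0 <= intsq (@g n))%E by move=> *; exact: intsq_ge0.
set S := (\sum_(1 <= n <oo) _)%E.
have SV : (S <= (var L F)%:E)%E.
  apply: lime_le; first exact: is_cvg_nneseries.
  apply: nearW => -[|N]; last exact: sum_intsq_le_var.
  by rewrite big_geq// lee_fin sqr_ge0.
have S0 : (0 <= S)%E by exact: nneseries_ge0.
apply/eqP; rewrite eq_le SV andbT.
have Sfin : S \is a fin_num by rewrite ge0_fin_numE// (le_lt_trans SV)// ltry.
rewrite -(fineK Sfin) lee_fin; set s := fine S.
have s0 : 0 <= s by exact: fine_ge0.
have V0 : 0 <= var L F by exact: sqr_ge0.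
(* For [e <= 1], (1 + e)^2 s + 4 (1 + e)^2 e + (1 + e) e <= s + 3 e s + 16 e + 2 e. *)
have H (e : R) : 0 < e -> e <= 1 -> var L F <= s + e * (3 * s + 18).
  move=> e0 e1; have [P PF] := dense (exprn_gt0 2 e0).
  have PF' : (1 + e^-1) * d P <= (1 + e) * e.
    rewrite (_ : (1 + e) * e = (1 + e^-1) * e ^+ 2); last by field; rewrite gt_eqF.
    apply: ler_wpM2l; last exact: ltW.
    by rewrite addr_ge0// invr_ge0 ltW.
  have := @varD_le _ _ L _ F (pol_L2 L P) e0; rewrite hnorm_distC -/(d P) => vF.
  (* The series is truncated at the degree of [P], where the formula for [P] is already an
     equality. *)
  have sg : (\sum_(1 <= n < (pol_size P).+1) intsq (@g n) <= s%:E)%E.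
    by rewrite fineK//; exact: nneseries_lim_ge.
  have := @sum_intsqD_le R e s (4 * d P) 1 (pol_size P).+1
    (@f P) g (fun n t => @f P n t - @g n t) e0 cmg (cmfg P).
  rewrite (sum_chaos_kernel L)// lee_fin => vP.
  have {}vP : var L (pol_L2 L P) <= (1 + e) * s + (1 + e^-1) * (4 * d P).
    by apply: vP => //; [move=> k t; rewrite addrC subrK|exact: sum_intsq_sub_le].
  have e2 : e * e <= e by rewrite ger_pMl.
  have : (1 + e) * var L (pol_L2 L P) <= (1 + e) * ((1 + e) * s + 4 * ((1 + e) * e)).
    rewrite ler_pM2l ?ltr_pwDl//; last exact: ltW.
    by rewrite (le_trans vP)// lerD2l mulrCA ler_pM2l.
  have : e * e * s <= e * s by rewrite ler_wpM2r.
  have : e * e * e <= e * e by rewrite ger_pMr// mulr_gt0.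
  nra.
apply/ler_addgt0Pr => e e0.
have C0 : 0 < 3 * s + 18 by rewrite ltr_wpDl// mulr_ge0.
pose e' := Num.min 1 (e / (3 * s + 18)).
have e'0 : 0 < e' by rewrite lt_min ltr01 divr_gt0.
apply: le_trans (H e' e'0 _) _; first by rewrite ge_min lexx.
by rewrite lerD2l -ler_pdivlMr// ge_min lexx orbT.
Qed.

End closure.

Theorem proposition24 (R : realType) (Fk : fock R)
    (L : forall k : nat, tensL2 Fk k) (F : L 1%N)
    (hF : Doo2 L F)
    (nablaF : forall n : nat, n.-tuple R -> L n.+1)
    (hnablaF : forall n : nat, (1 <= n)%N -> closed_nablan L F (nablaF n)) :
  (var L F)%:E =
  (\sum_(1 <= n <oo)
     \int[lebn R n]_t (ComplexField.Normc.normc (tauL2 (nablaF n t)) ^+ 2)%:E)%E.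
Proof.
rewrite (var_sum_intsq hnablaF); apply: eq_eseriesr => n _.
by apply: eq_integral => t _; rewrite normsqE.
Qed.
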